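(* Let $r>0$. For any left $\mathfrak{E}(r)$-module $W$, $$\mathcal{H}_0(W):=\mathrm{Hom}_{\mathfrak{E}(r)}(\Lambda_r,W)\cong \{w\in W \mid P_{a,i}w=0\ \ \forall a>0,\ i\in [r]\}.$$ For any left $\mathcal{E}(r)$-module $V$, $$\mathfrak{H}_{\infty}(V):=\Lambda_r\otimes_{\mathcal{E}(r)}V=\varinjlim_{a\to +\infty} (t^{a}V),$$ where $t^aV$ is a copy of $V$ for every $a\in \mathbb{Z}$ and the transition map $t^{a}V\to t^{a+1}V$ is $t^av\mapsto t^{a+1}\cdot (ev)$. In particular, each $t^aV$ is a $\mathbb{Z}$-submodule of $\mathfrak{H}_{\infty}(V)$.
   Context: $[r]=\{0,\dots,r-1\}$; all algebras are over $\mathbb{Z}$, unital and associative. $\mathrm{Cl}(r)$ is generated by $p_i,q_i$ ($i\in[r]$) with $p_i^2=q_i^2=0$, $\{p_i,p_j\}=\{q_i,q_j\}=0$, $\{p_i,q_j\}=\delta_{ij}$. Put $p_{[r]}=p_{r-1}\cdots p_0$, $q_{[r]}=q_0\cdots q_{r-1}$. $\mathcal{E}(r)$ is generated by $\mathrm{Cl}(r)$ and elements $e,f$ with relations $p_ie=0$, $fq_i=0$, $fe=1$, $ef=p_{[r]}q_{[r]}$. $\mathfrak{E}(r)$ is generated by $P_{a,i},Q_{a,i}$ ($a\in\mathbb{Z}$, $i\in[r]$) and an invertible element $E$ with relations $P_{a,i}^2=Q_{a,i}^2=0$, $EP_{a,i}=P_{a-1,i}E$, $EQ_{a,i}=Q_{a-1,i}E$,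 $\{P_{a,i},P_{b,j}\}=\{Q_{a,i},Q_{b,j}\}=0$, $\{P_{a,i},Q_{b,j}\}=\delta_{ij}\delta_{ab}$. Put $F=E^{-1}$, $P_{0,[r]}=P_{0,r-1}\cdots P_{0,0}$, $Q_{0,[r]}=Q_{0,0}\cdots Q_{0,r-1}$. $\Lambda_r$ is the left $\mathfrak{E}(r)$-module with one generator $1_{\Lambda_r}$ and relations $P_{a,i}1_{\Lambda_r}=0$ for $a>0$, $i\in[r]$. It is an $\mathfrak{E}(r)$-$\mathcal{E}(r)$-bimodule with right action determined by $1_{\Lambda_r}e=E1_{\Lambda_r}$, $1_{\Lambda_r}f=FP_{0,[r]}Q_{0,[r]}1_{\Lambda_r}$, $1_{\Lambda_r}p_i=P_{0,i}1_{\Lambda_r}$, $1_{\Lambda_r}q_i=Q_{0,i}1_{\Lambda_r}$. *)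

(* Defs.v *)
From HB Require Import structures.
From mathcomp Require Import all_boot all_order all_algebra.
From mathcomp Require Import finmap boolp.
From mathcomp.multinomials Require Import monalg.

Set Implicit Arguments.
Unset Strict Implicit.
Unset Printing Implicit Defensive.

Import Order.TTheory GRing.Theory Num.Theory.
Local Open Scope ring_scope.
Local Open Scope quotient_scope.

Section Quotient.
Variables (V : zmodType) (S : V -> Prop).

Inductive zspan_spec : V -> Prop :=
| zspan_mem x : S x -> zspan_spec x
| zspan_0 : zspan_spec 0
| zspan_B x y : zspan_spec x -> zspan_spec y -> zspan_spec (x - y).

Definition zspan : {pred V} := fun x => `[< zspan_spec x >].

Fact zspan_zmod_closed : zmod_closed zspan.
Proof.
split; first by apply/asboolP/zspan_0.
by move=> x y /asboolP xS /asboolP yS; apply/asboolP/zspan_B.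
Qed.
HB.instance Definition _ := GRing.isZmodClosed.Build V zspan zspan_zmod_closed.

Definition zquot := {ideal_quot zspan}.
HB.instance Definition _ := GRing.Zmodule.on zquot.

Definition zpi (x : V) : zquot := \pi x.

Lemma zpi_is_zmod_morphism : zmod_morphism zpi.
Proof. by move=> x y; rewrite /zpi !piE. Qed.
HB.instance Definition _ :=
  GRing.isZmodMorphism.Build V zquot zpi zpi_is_zmod_morphism.

Lemma zpiP (x y : V) : zpi x = zpi y <-> zspan_spec (x - y).
Proof.
have E := Quotient.idealrBE zspan x y.
split=> [/eqP|].
  by rewrite -E => /asboolP.
by move=> h; apply/eqP; rewrite -E; apply/asboolP.
Qed.

Lemma zpi_surj (u : zquot) : exists x, u = zpi x.
Proof. by exists (repr u); rewrite /zpi reprK. Qed.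

Section Lift.
Variables (W : zmodType) (f : {additive V -> W}).
Hypothesis f0 : forall x, S x -> f x = 0.

Lemma zspan_ker x : zspan_spec x -> f x = 0.
Proof. by elim=> [//||a b _ fa _ fb]; rewrite ?raddf0 // raddfB fa fb subr0. Qed.

Definition zlift of (forall x, S x -> f x = 0) := fun u : zquot => f (repr u).
Local Notation lift := (zlift f0).

Lemma zliftE x : lift (zpi x) = f x.
Proof.
apply/eqP; rewrite -subr_eq0 -raddfB; apply/eqP/zspan_ker/zpiP.
by rewrite /zpi reprK.
Qed.

Lemma zlift_is_zmod_morphism : zmod_morphism lift.
Proof.
move=> u v; have [x ->] := zpi_surj u; have [y ->] := zpi_surj v.
by rewrite -raddfB !zliftE raddfB.
Qed.
HB.instance Definition _ :=
  GRing.isZmodMorphism.Build zquot W lift zlift_is_zmod_morphism.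
End Lift.
End Quotient.

Section FreeAbelian.
Variables (K : choiceType) (V : zmodType) (h : K -> V).

Definition malg_lift (g : {malg int[K]}) : V := \sum_(k <- msupp g) h k *~ g@_k.

Lemma malg_liftEw (d : {fset K}) (g : {malg int[K]}) : (msupp g `<=` d)%fset ->
  malg_lift g = \sum_(k <- d) h k *~ g@_k.
Proof.
move=> le; rewrite [LHS](big_fset_incl _ le) => //= x xd /mcoeff_outdom ->.
by rewrite mulr0z.
Qed.

Lemma malg_lift_is_zmod_morphism : zmod_morphism malg_lift.
Proof.
move=> g1 g2; pose d := (msupp g1 `|` msupp g2 `|` msupp (g1 - g2))%fset.
rewrite !(@malg_liftEw d) /d; last 3 first.
- by apply/fsubsetP => x; rewrite !inE => ->; rewrite ?orbT.
- by apply/fsubsetP => x; rewrite !inE => ->; rewrite ?orbT.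
- by apply/fsubsetP => x; rewrite !inE => ->; rewrite ?orbT.
by rewrite -sumrB; apply: eq_bigr => k _; rewrite raddfB /= mulrzBr.
Qed.
HB.instance Definition _ := GRing.isZmodMorphism.Build {malg int[K]} V malg_lift
  malg_lift_is_zmod_morphism.

Lemma malg_liftU k : malg_lift << k >> = h k.
Proof.
by rewrite (malg_liftEw msuppU_le) big_seq_fset1 mcoeffUU mulr1z.
Qed.

Lemma malg_lift_uniq (f g : {additive {malg int[K]} -> V}) :
  (forall k, f << k >> = g << k >>) -> f =1 g.
Proof.
move=> fg x; rewrite [x]monalgE !raddf_sum; apply: eq_bigr => k _.
have -> : << x@_k *g k >> = << k >> *~ x@_k :> {malg int[K]}.
  by rewrite -[in LHS](intz x@_k) (raddfMz (@mkmalgU K int k)).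
by rewrite !raddfMz fg.
Qed.
End FreeAbelian.

Section RingQuotient.
Variables (F : pzRingType) (rel : F -> F -> Prop).

Definition rel_ideal_gen (z : F) : Prop :=
  exists a l r b : F, rel l r /\ z = a * (l - r) * b.

Definition ring_quot := zquot rel_ideal_gen.
HB.instance Definition _ := GRing.Zmodule.on ring_quot.

Local Notation pi := (zpi rel_ideal_gen).

Lemma rel_ideal_mull c z :
  zspan_spec rel_ideal_gen z -> zspan_spec rel_ideal_gen (c * z).
Proof.
elim=> [_ [a [l [r [b [lr ->]]]]]||x y _ hx _ hy].
- by apply: zspan_mem; exists (c * a), l, r, b; rewrite !mulrA.
- by rewrite mulr0; apply: zspan_0.
- by rewrite mulrBr; apply: zspan_B.
Qed.

Lemma rel_ideal_mulr c z :
  zspan_spec rel_ideal_gen z -> zspan_spec rel_ideal_gen (z * c).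
Proof.
elim=> [_ [a [l [r [b [lr ->]]]]]||x y _ hx _ hy].
- by apply: zspan_mem; exists a, l, r, (b * c); rewrite !mulrA.
- by rewrite mul0r; apply: zspan_0.
- by rewrite mulrBl; apply: zspan_B.
Qed.

Definition rquot_one : ring_quot := pi 1.
Definition rquot_mul (u v : ring_quot) : ring_quot := pi (repr u * repr v).

Lemma rquot_mulE x y : rquot_mul (pi x) (pi y) = pi (x * y).
Proof.
have reprP z : zspan_spec rel_ideal_gen (repr (pi z) - z).
  by apply/zpiP; rewrite {1}/zpi reprK.
rewrite /rquot_mul; set x' := repr (pi x); set y' := repr (pi y).
have -> : pi (x' * y') = pi (x' * y).
  by apply/zpiP; rewrite -mulrBr; apply/rel_ideal_mull/reprP.
by apply/zpiP; rewrite -mulrBl; apply/rel_ideal_mulr/reprP.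
Qed.

Fact rquot_mulA : associative rquot_mul.
Proof.
move=> u v w; have [x ->] := zpi_surj u; have [y ->] := zpi_surj v.
by have [z ->] := zpi_surj w; rewrite !rquot_mulE mulrA.
Qed.
Fact rquot_mul1r : left_id rquot_one rquot_mul.
Proof. by move=> u; have [x ->] := zpi_surj u; rewrite rquot_mulE mul1r. Qed.
Fact rquot_mulr1 : right_id rquot_one rquot_mul.
Proof. by move=> u; have [x ->] := zpi_surj u; rewrite rquot_mulE mulr1. Qed.
Fact rquot_mulDl : left_distributive rquot_mul +%R.
Proof.
move=> u v w; have [x ->] := zpi_surj u; have [y ->] := zpi_surj v.
by have [z ->] := zpi_surj w; rewrite -raddfD !rquot_mulE mulrDl raddfD.
Qed.
Fact rquot_mulDr : right_distributive rquot_mul +%R.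
Proof.
move=> u v w; have [x ->] := zpi_surj u; have [y ->] := zpi_surj v.
by have [z ->] := zpi_surj w; rewrite -raddfD !rquot_mulE mulrDr raddfD.
Qed.
HB.instance Definition _ := GRing.Zmodule_isPzRing.Build ring_quot
  rquot_mulA rquot_mul1r rquot_mulr1 rquot_mulDl rquot_mulDr.

Definition rquot_pi : F -> ring_quot := pi.
HB.instance Definition _ := GRing.Additive.on rquot_pi.

Fact rquot_pi_is_monoid_morphism : monoid_morphism rquot_pi.
Proof. by split=> [//|x y]; exact/esym/rquot_mulE. Qed.
HB.instance Definition _ :=
  GRing.isMonoidMorphism.Build F ring_quot rquot_pi rquot_pi_is_monoid_morphism.

Lemma rquot_rel l r : rel l r -> rquot_pi l = rquot_pi r.
Proof.
move=> lr; apply/zpiP/zspan_mem; exists 1, l, r, 1.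
by rewrite mul1r mulr1.
Qed.

Lemma rquot_surj (u : ring_quot) : exists x, u = rquot_pi x.
Proof. exact: zpi_surj. Qed.

Section Lift.
Variables (A : pzRingType) (g : {rmorphism F -> A}).
Hypothesis relP : forall l r, rel l r -> g l = g r.

Lemma rel_ideal_ker z : rel_ideal_gen z -> g z = 0.
Proof.
move=> [a [l [r [b [lr ->]]]]].
by rewrite !rmorphM rmorphB /= (relP lr) subrr mulr0 mul0r.
Qed.

Definition rquot_lift : ring_quot -> A := zlift rel_ideal_ker.
HB.instance Definition _ := GRing.Additive.on rquot_lift.

Lemma rquot_liftE z : rquot_lift (rquot_pi z) = g z.
Proof. exact: zliftE. Qed.

Fact rquot_lift_is_monoid_morphism : monoid_morphism rquot_lift.
Proof.
split; first by rewrite -(rmorph1 rquot_pi) rquot_liftE rmorph1.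
move=> u v; have [x ->] := rquot_surj u; have [y ->] := rquot_surj v.
by rewrite -rmorphM !rquot_liftE rmorphM.
Qed.
HB.instance Definition _ := GRing.isMonoidMorphism.Build ring_quot A rquot_lift
  rquot_lift_is_monoid_morphism.
End Lift.
End RingQuotient.

Notation free_ring X := {malg int[{fmonom X}]}.

Section FreeRing.
Variable X : choiceType.

Definition free_gen (x : X) : free_ring X := << fmu x >>.

Variables (A : pzRingType) (h : X -> A).

Definition free_lift : free_ring X -> A :=
  malg_lift (fun w : {fmonom X} => \prod_(x <- (w : seq X)) h x).
HB.instance Definition _ := GRing.Additive.on free_lift.

Lemma free_lift_word (w : {fmonom X}) :
  free_lift << w >> = \prod_(x <- (w : seq X)) h x.
Proof. exact: malg_liftU. Qed.

Lemma free_lift_gen x : free_lift (free_gen x) = h x.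
Proof. by rewrite free_lift_word fmuE big_seq1. Qed.

Fact free_lift_is_monoid_morphism : monoid_morphism free_lift.
Proof.
split; first by rewrite free_lift_word fm1 big_nil.
move=> x y; apply: (malg_lift_uniq (f := free_lift \o (x \*o idfun))
  (g := free_lift x \*o free_lift)) => k /=.
apply: (malg_lift_uniq (f := free_lift \o (<< k >> \o* idfun))
  (g := free_lift << k >> \o* free_lift)) => j /=.
by rewrite malgM_def fgmulUU mulr1 !free_lift_word -big_cat fmM.
Qed.
HB.instance Definition _ := GRing.isMonoidMorphism.Build (free_ring X) A
  free_lift free_lift_is_monoid_morphism.
End FreeRing.

Section CyclicModule.
Variables (A : pzRingType) (S : A -> Prop).

Definition left_ideal_gen (z : A) : Prop := exists a s, S s /\ z = a * s.

Definition cyclic_mod := zquot left_ideal_gen.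
HB.instance Definition _ := GRing.Zmodule.on cyclic_mod.

Local Notation pi := (zpi left_ideal_gen).

Lemma left_ideal_mull a z :
  zspan_spec left_ideal_gen z -> zspan_spec left_ideal_gen (a * z).
Proof.
elim=> [_ [b [s [Ss ->]]]||x y _ hx _ hy].
- by apply: zspan_mem; exists (a * b), s; rewrite mulrA.
- by rewrite mulr0; apply: zspan_0.
- by rewrite mulrBr; apply: zspan_B.
Qed.

Definition cyclic_scale (a : A) (u : cyclic_mod) : cyclic_mod := pi (a * repr u).

Lemma cyclic_scaleE a x : cyclic_scale a (pi x) = pi (a * x).
Proof.
apply/zpiP; rewrite -mulrBr; apply/left_ideal_mull/zpiP.
by rewrite {1}/zpi reprK.
Qed.

Fact cyclic_scaleA a b u :
  cyclic_scale a (cyclic_scale b u) = cyclic_scale (a * b) u.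
Proof. by have [x ->] := zpi_surj u; rewrite !cyclic_scaleE mulrA. Qed.
Fact cyclic_scale1 : left_id 1 cyclic_scale.
Proof. by move=> u; have [x ->] := zpi_surj u; rewrite cyclic_scaleE mul1r. Qed.
Fact cyclic_scaleDr : right_distributive cyclic_scale +%R.
Proof.
move=> a u v; have [x ->] := zpi_surj u; have [y ->] := zpi_surj v.
by rewrite -raddfD !cyclic_scaleE mulrDr raddfD.
Qed.
Fact cyclic_scaleDl u : {morph cyclic_scale^~ u : a b / a + b}.
Proof.
by move=> a b; have [x ->] := zpi_surj u; rewrite !cyclic_scaleE mulrDl raddfD.
Qed.
HB.instance Definition _ := GRing.Zmodule_isLmodule.Build A cyclic_mod
  cyclic_scaleA cyclic_scale1 cyclic_scaleDr cyclic_scaleDl.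

Definition cyclic_gen : cyclic_mod := pi 1.

Lemma cyclic_genE x : pi x = x *: cyclic_gen.
Proof. by rewrite -[RHS]/(cyclic_scale _ _) cyclic_scaleE mulr1. Qed.

Lemma cyclic_gen_surj (u : cyclic_mod) : exists x, u = x *: cyclic_gen.
Proof. by have [x ->] := zpi_surj u; exists x; rewrite cyclic_genE. Qed.

Lemma cyclic_rel s : S s -> s *: cyclic_gen = 0.
Proof.
move=> Ss; rewrite -cyclic_genE -(raddf0 pi); apply/zpiP/zspan_mem.
by exists 1, s; rewrite mul1r subr0.
Qed.

Section Lift.
Variables (W : lmodType A) (w : W).
Hypothesis wP : forall s, S s -> s *: w = 0.

Definition cyclic_orbit (x : A) : W := x *: w.
Fact cyclic_orbit_is_zmod_morphism : zmod_morphism cyclic_orbit.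
Proof. by move=> x y; rewrite /cyclic_orbit scalerBl. Qed.
HB.instance Definition _ :=
  GRing.isZmodMorphism.Build A W cyclic_orbit cyclic_orbit_is_zmod_morphism.

Fact cyclic_orbit0 z : left_ideal_gen z -> cyclic_orbit z = 0.
Proof.
by move=> [a [s [Ss ->]]]; rewrite /cyclic_orbit -scalerA wP // scaler0.
Qed.

Definition cyclic_lift : cyclic_mod -> W := zlift cyclic_orbit0.
Local Notation lift := cyclic_lift.
HB.instance Definition _ := GRing.Additive.on lift.

Lemma cyclic_lift_scale_gen x : lift (x *: cyclic_gen) = x *: w.
Proof. by rewrite -cyclic_genE [LHS]zliftE. Qed.

Lemma cyclic_lift_gen : lift cyclic_gen = w.
Proof. by rewrite -[cyclic_gen]scale1r cyclic_lift_scale_gen scale1r. Qed.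

Fact cyclic_lift_is_scalable : scalable lift.
Proof.
move=> a u; have [x ->] := cyclic_gen_surj u.
by rewrite scalerA !cyclic_lift_scale_gen scalerA.
Qed.
HB.instance Definition _ :=
  GRing.isScalable.Build A cyclic_mod W *:%R lift cyclic_lift_is_scalable.
End Lift.
End CyclicModule.

Section LinearHom.
Variables (A : pzRingType) (M N : lmodType A).

Lemma linear_ext (f g : {linear M -> N}) : f =1 g -> f = g.
Proof.
case: f g => [f [[fa] [fs]]] [g [[ga] [gs]]] /= fg.
have {}fg : f = g by apply: funext.
by subst g; rewrite (Prop_irrelevance fa ga) (Prop_irrelevance fs gs).
Qed.

Definition lhom := {linear M -> N}.
HB.instance Definition _ := gen_eqMixin lhom.
HB.instance Definition _ := gen_choiceMixin lhom.

Definition lhom0 : lhom := \0.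
Definition lhomN (f : lhom) : lhom := \- f.
Definition lhomD (f g : lhom) : lhom := f \+ g.

Fact lhomDA : associative lhomD.
Proof. by move=> f g h; apply: linear_ext => x /=; rewrite addrA. Qed.
Fact lhomDC : commutative lhomD.
Proof. by move=> f g; apply: linear_ext => x /=; rewrite addrC. Qed.
Fact lhom0D : left_id lhom0 lhomD.
Proof. by move=> f; apply: linear_ext => x /=; rewrite add0r. Qed.
Fact lhomND : left_inverse lhom0 lhomN lhomD.
Proof. by move=> f; apply: linear_ext => x /=; rewrite addNr. Qed.
HB.instance Definition _ := GRing.isZmodule.Build lhom lhomDA lhomDC lhom0D lhomND.

Lemma lhomDE (f g : lhom) x : (f + g) x = f x + g x. Proof. by []. Qed.
Lemma lhomBE (f g : lhom) x : (f - g) x = f x - g x. Proof. by []. Qed.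
End LinearHom.

Section LinearEnd.
Variables (A : pzRingType) (M : lmodType A).

Definition lend := lhom M M.
HB.instance Definition _ := GRing.Zmodule.on lend.

Definition lend1 : lend := idfun.
Definition lendM (f g : lend) : lend := f \o g.

Fact lendMA : associative lendM.
Proof. by move=> f g h; apply: linear_ext. Qed.
Fact lend1M : left_id lend1 lendM.
Proof. by move=> f; apply: linear_ext. Qed.
Fact lendM1 : right_id lend1 lendM.
Proof. by move=> f; apply: linear_ext. Qed.
Fact lendDM : left_distributive lendM +%R.
Proof. by move=> f g h; apply: linear_ext. Qed.
Fact lendMD : right_distributive lendM +%R.
Proof. by move=> f g h; apply: linear_ext => x /=; exact: raddfD. Qed.
HB.instance Definition _ :=
  GRing.Zmodule_isPzRing.Build lend lendMA lend1M lendM1 lendDM lendMD.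
End LinearEnd.

Record bimodule (A R : pzRingType) := Bimodule {
  bimodule_lmod :> lmodType A;
  ract : R -> {linear bimodule_lmod -> bimodule_lmod};
  ract1 : forall m, ract 1 m = m;
  ractM : forall x y m, ract (x * y) m = ract y (ract x m);
  ractD : forall x y m, ract (x + y) m = ract x m + ract y m
}.
Arguments ract {A R M} x : rename.

Notation "m <* x" := (ract x m) (at level 40, left associativity) : ring_scope.

Section HomModule.
Variables (A R : pzRingType) (M : bimodule A R) (W : lmodType A).

Definition bhom := lhom M W.
HB.instance Definition _ := GRing.Zmodule.on bhom.

Definition bhom_scale (x : R) (f : bhom) : bhom := f \o ract x.

Fact bhom_scaleA x y f : bhom_scale x (bhom_scale y f) = bhom_scale (x * y) f.
Proof. by apply: linear_ext => m /=; rewrite ractM. Qed.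
Fact bhom_scale1 : left_id 1 bhom_scale.
Proof. by move=> f; apply: linear_ext => m /=; rewrite ract1. Qed.
Fact bhom_scaleDr : right_distributive bhom_scale +%R.
Proof. by move=> x f g; apply: linear_ext. Qed.
Fact bhom_scaleDl f : {morph bhom_scale^~ f : x y / x + y}.
Proof. by move=> x y; apply: linear_ext => m /=; rewrite ractD raddfD. Qed.
HB.instance Definition _ := GRing.Zmodule_isLmodule.Build R bhom
  bhom_scaleA bhom_scale1 bhom_scaleDr bhom_scaleDl.
End HomModule.

Section TensorProduct.
Variables (A R : pzRingType) (M : bimodule A R) (V : lmodType R).
Local Notation F := {malg int[(M * V)%type]}.

Inductive tensor_rel : F -> Prop :=
| tensor_rel_addl m m' v :
    tensor_rel (<< (m + m', v) >> - (<< (m, v) >> + << (m', v) >>))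
| tensor_rel_addr m v v' :
    tensor_rel (<< (m, v + v') >> - (<< (m, v) >> + << (m, v') >>))
| tensor_rel_balance m x v :
    tensor_rel (<< (m <* x, v) >> - << (m, x *: v) >>).

Definition tensor := zquot tensor_rel.
HB.instance Definition _ := GRing.Zmodule.on tensor.

Definition tpure (m : M) (v : V) : tensor := zpi tensor_rel << (m, v) >>.
Local Notation "m ⊗ v" := (tpure m v) (at level 40).

Lemma tpureDl m m' v : (m + m') ⊗ v = m ⊗ v + m' ⊗ v.
Proof. by rewrite -raddfD; apply/zpiP/zspan_mem/tensor_rel_addl. Qed.
Lemma tpureDr m v v' : m ⊗ (v + v') = m ⊗ v + m ⊗ v'.
Proof. by rewrite -raddfD; apply/zpiP/zspan_mem/tensor_rel_addr. Qed.
Lemma tpure_balance m x v : (m <* x) ⊗ v = m ⊗ (x *: v).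
Proof. exact/zpiP/zspan_mem/tensor_rel_balance. Qed.

Fact tpure_is_zmod_morphism m : zmod_morphism (tpure m).
Proof.
by move=> u v; apply/eqP; rewrite eq_sym subr_eq -tpureDr subrK.
Qed.
HB.instance Definition _ m :=
  GRing.isZmodMorphism.Build V tensor (tpure m) (tpure_is_zmod_morphism m).

Section Lift.
Variables (T : zmodType) (h : M -> V -> T).
Hypothesis hDl : forall m m' v, h (m + m') v = h m v + h m' v.
Hypothesis hDr : forall m v v', h m (v + v') = h m v + h m v'.
Hypothesis hbal : forall m x v, h (m <* x) v = h m (x *: v).

Lemma tensor_rel_lift z : tensor_rel z -> malg_lift (fun p => h p.1 p.2) z = 0.
Proof.
by case=> *; rewrite raddfB ?raddfD /= !malg_liftU /= ?hDl ?hDr ?hbal -?opprD subrr.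
Qed.

Lemma tensor_lift_ex :
  exists g : {additive tensor -> T}, forall m v, g (m ⊗ v) = h m v.
Proof.
exists (zlift tensor_rel_lift) => m v.
by rewrite [LHS]zliftE; exact: malg_liftU.
Qed.
End Lift.

Lemma tensor_uniq (T : zmodType) (f g : {additive tensor -> T}) :
  (forall m v, f (m ⊗ v) = g (m ⊗ v)) -> f =1 g.
Proof.
move=> fg u; have [x ->] := zpi_surj u.
apply: (malg_lift_uniq (f := f \o zpi _) (g := g \o zpi _)) => -[m v] /=.
exact: fg.
Qed.

Section Scale.
Variable a : A.
Let h m v := (a *: m) ⊗ v.

Fact tensor_scale_rel z :
  tensor_rel z -> malg_lift (fun p => h p.1 p.2) z = 0.
Proof.
apply: tensor_rel_lift => *; rewrite /h ?scalerDr ?tpureDl ?tpureDr //.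
by rewrite -linearZ tpure_balance.
Qed.

Definition tensor_scale : tensor -> tensor := zlift tensor_scale_rel.
HB.instance Definition _ := GRing.Additive.on tensor_scale.

Lemma tensor_scale_pure m v : tensor_scale (m ⊗ v) = (a *: m) ⊗ v.
Proof. by rewrite [LHS]zliftE; exact: malg_liftU. Qed.
End Scale.

Fact tensor_scaleA a b u :
  tensor_scale a (tensor_scale b u) = tensor_scale (a * b) u.
Proof.
move: u; apply: (tensor_uniq (f := tensor_scale a \o tensor_scale b)) => m v /=.
by rewrite !tensor_scale_pure scalerA.
Qed.
Fact tensor_scale1 : left_id 1 tensor_scale.
Proof.
apply: (tensor_uniq (g := idfun)) => m v /=.
by rewrite tensor_scale_pure scale1r.
Qed.
Fact tensor_scaleDr : right_distributive tensor_scale +%R.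
Proof. by move=> a u v; rewrite raddfD. Qed.
Fact tensor_scaleDl u : {morph tensor_scale^~ u : a b / a + b}.
Proof.
move=> a b; move: u.
apply: (tensor_uniq (g := tensor_scale a \+ tensor_scale b)) => m v /=.
by rewrite !tensor_scale_pure scalerDl tpureDl.
Qed.
HB.instance Definition _ := GRing.Zmodule_isLmodule.Build A tensor
  tensor_scaleA tensor_scale1 tensor_scaleDr tensor_scaleDl.

Lemma tensor_scaleE a m v : a *: (m ⊗ v) = (a *: m) ⊗ v.
Proof. exact: tensor_scale_pure. Qed.
End TensorProduct.
Notation "m ⊗ v" := (tpure m v) (at level 40) : ring_scope.

Inductive clifford_rel (A : pzRingType) (I : eqType) (p q : I -> A) :
  A -> A -> Prop :=
| clifford_p2 i : clifford_rel p q (p i ^+ 2) 0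
| clifford_q2 i : clifford_rel p q (q i ^+ 2) 0
| clifford_pp i j : clifford_rel p q (p i * p j + p j * p i) 0
| clifford_qq i j : clifford_rel p q (q i * q j + q j * q i) 0
| clifford_pq i j : clifford_rel p q (p i * q j + q j * p i) (i == j)%:R.

(* rev_ord i = r-1-i, so the first product is p_{r-1} ... p_0. *)
Definition prod_desc (A : pzRingType) r (p : 'I_r -> A) : A :=
  \prod_(i < r) p (rev_ord i).
Definition prod_asc (A : pzRingType) r (q : 'I_r -> A) : A := \prod_(i < r) q i.

Section Relations.
Variables (A : pzRingType) (r : nat).

Inductive calE_rel (p q : 'I_r -> A) (e f : A) : A -> A -> Prop :=
| calE_Cl x y : clifford_rel p q x y -> calE_rel p q e f x y
| calE_pe i : calE_rel p q e f (p i * e) 0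
| calE_fq i : calE_rel p q e f (f * q i) 0
| calE_fe : calE_rel p q e f (f * e) 1
| calE_ef : calE_rel p q e f (e * f) (prod_desc p * prod_asc q).

(* The relations among the P_{a,i}, Q_{a,i} are the Clifford relations with
   index set Z x [r], since delta_{ij} delta_{ab} = delta_{(a,i),(b,j)}. *)
Inductive frakE_rel (P Q : int -> 'I_r -> A) (E F : A) : A -> A -> Prop :=
| frakE_Cl x y :
    clifford_rel (fun k : int * 'I_r => P k.1 k.2)
                 (fun k : int * 'I_r => Q k.1 k.2) x y ->
    frakE_rel P Q E F x y
| frakE_EF : frakE_rel P Q E F (E * F) 1
| frakE_FE : frakE_rel P Q E F (F * E) 1
| frakE_EP a i : frakE_rel P Q E F (E * P a i) (P (a - 1) i * E)
| frakE_EQ a i : frakE_rel P Q E F (E * Q a i) (Q (a - 1) i * E).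
End Relations.

Section RelationsMorphism.
Variables (A B : pzRingType) (g : {rmorphism A -> B}).

Lemma rmorph_prod_desc r (p : 'I_r -> A) :
  g (prod_desc p) = prod_desc (fun i => g (p i)).
Proof. exact: rmorph_prod. Qed.

Lemma rmorph_prod_asc r (p : 'I_r -> A) :
  g (prod_asc p) = prod_asc (fun i => g (p i)).
Proof. exact: rmorph_prod. Qed.

Lemma clifford_rel_rmorph (I : eqType) (p q : I -> A) x y :
  clifford_rel p q x y ->
  clifford_rel (fun i => g (p i)) (fun i => g (q i)) (g x) (g y).
Proof.
case=> [i|i|i j|i j|i j].
- rewrite rmorphXn rmorph0; exact: (clifford_p2 (fun i => g (p i))).
- rewrite rmorphXn rmorph0; exact: (clifford_q2 _ (fun i => g (q i))).
- rewrite rmorphD !rmorphM rmorph0; exact: (clifford_pp (fun i => g (p i))).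
- rewrite rmorphD !rmorphM rmorph0; exact: (clifford_qq _ (fun i => g (q i))).
- rewrite rmorphD !rmorphM rmorph_nat.
  exact: (clifford_pq (fun i => g (p i)) (fun i => g (q i))).
Qed.

Lemma calE_rel_rmorph r (p q : 'I_r -> A) e f x y :
  calE_rel p q e f x y ->
  calE_rel (fun i => g (p i)) (fun i => g (q i)) (g e) (g f) (g x) (g y).
Proof.
case=> [u v /clifford_rel_rmorph|i|i||]; first exact: calE_Cl.
- by rewrite rmorphM rmorph0; exact: (calE_pe (fun i => g (p i))).
- by rewrite rmorphM rmorph0; exact: (calE_fq _ (fun i => g (q i))).
- by rewrite rmorphM rmorph1; constructor.
- by rewrite !rmorphM rmorph_prod_desc rmorph_prod_asc; constructor.
Qed.

Lemma frakE_rel_rmorph r (P Q : int -> 'I_r -> A) E F x y :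
  frakE_rel P Q E F x y ->
  frakE_rel (fun a i => g (P a i)) (fun a i => g (Q a i)) (g E) (g F)
    (g x) (g y).
Proof.
case=> [u v /clifford_rel_rmorph|||a i|a i]; first exact: frakE_Cl.
- by rewrite rmorphM rmorph1; constructor.
- by rewrite rmorphM rmorph1; constructor.
- by rewrite !rmorphM /=; apply: (frakE_EP (fun a i => g (P a i))).
- by rewrite !rmorphM /=; apply: (frakE_EQ _ (fun a i => g (Q a i))).
Qed.

Lemma clifford_rel_image (I : eqType) (p q : I -> A) :
  (forall x y, clifford_rel p q x y -> g x = g y) ->
  forall x y, clifford_rel (fun i => g (p i)) (fun i => g (q i)) x y -> x = y.
Proof.
move=> H x y; case=> [k|k|k l|k l|k l].
- by have := H _ _ (clifford_p2 _ _ k); rewrite rmorph0 rmorphXn.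
- by have := H _ _ (clifford_q2 _ _ k); rewrite rmorph0 rmorphXn.
- by have := H _ _ (clifford_pp _ _ k l); rewrite rmorph0 rmorphD !rmorphM.
- by have := H _ _ (clifford_qq _ _ k l); rewrite rmorph0 rmorphD !rmorphM.
- by have := H _ _ (clifford_pq _ _ k l); rewrite rmorph_nat rmorphD !rmorphM.
Qed.

Lemma calE_rel_image r (p q : 'I_r -> A) e f :
  (forall x y, calE_rel p q e f x y -> g x = g y) ->
  forall x y,
  calE_rel (fun i => g (p i)) (fun i => g (q i)) (g e) (g f) x y -> x = y.
Proof.
move=> H x y; case=> [u v|i|i||].
- by apply: clifford_rel_image => z t zt; apply/H/calE_Cl.
- by have := H _ _ (calE_pe _ _ _ _ i); rewrite rmorph0 rmorphM.
- by have := H _ _ (calE_fq _ _ _ _ i); rewrite rmorph0 rmorphM.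
- by have := H _ _ (calE_fe _ _ _ _); rewrite rmorph1 rmorphM.
- have := H _ _ (calE_ef _ _ _ _).
  by rewrite !rmorphM rmorph_prod_desc rmorph_prod_asc.
Qed.

Lemma frakE_rel_image r (P Q : int -> 'I_r -> A) E F :
  (forall x y, frakE_rel P Q E F x y -> g x = g y) ->
  forall x y,
  frakE_rel (fun a i => g (P a i)) (fun a i => g (Q a i)) (g E) (g F) x y ->
  x = y.
Proof.
move=> H x y; case=> [u v|||a i|a i].
- apply: (clifford_rel_image (p := fun k : int * 'I_r => P k.1 k.2)) => z t zt.
  exact/H/frakE_Cl.
- by have := H _ _ (frakE_EF _ _ _ _); rewrite rmorph1 rmorphM.
- by have := H _ _ (frakE_FE _ _ _ _); rewrite rmorph1 rmorphM.
- by have := H _ _ (frakE_EP _ _ _ _ a i); rewrite !rmorphM.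
- by have := H _ _ (frakE_EQ _ _ _ _ a i); rewrite !rmorphM.
Qed.
End RelationsMorphism.

Section CalE.
Variable r : nat.

Inductive calE_sym := Sp of 'I_r | Sq of 'I_r | Se | Sf.
HB.instance Definition _ := gen_eqMixin calE_sym.
HB.instance Definition _ := gen_choiceMixin calE_sym.

Definition calE_free_rel : free_ring calE_sym -> free_ring calE_sym -> Prop :=
  calE_rel (fun i => free_gen (Sp i)) (fun i => free_gen (Sq i))
           (free_gen Se) (free_gen Sf).

Definition calE := ring_quot calE_free_rel.
HB.instance Definition _ := GRing.PzRing.on calE.

Definition calE_gen (x : calE_sym) : calE := rquot_pi calE_free_rel (free_gen x).
Definition calE_p (i : 'I_r) : calE := calE_gen (Sp i).
Definition calE_q (i : 'I_r) : calE := calE_gen (Sq i).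
Definition calE_e : calE := calE_gen Se.
Definition calE_f : calE := calE_gen Sf.

Lemma calE_relP x y : calE_rel calE_p calE_q calE_e calE_f x y -> x = y.
Proof.
exact: (calE_rel_image (g := rquot_pi calE_free_rel) (@rquot_rel _ _)).
Qed.

Section Lift.
Variables (A : pzRingType) (h : calE_sym -> A).
Hypothesis hP : forall x y,
  calE_rel (fun i => h (Sp i)) (fun i => h (Sq i)) (h Se) (h Sf) x y -> x = y.

Fact calE_lift_subproof x y :
  calE_free_rel x y -> free_lift h x = free_lift h y.
Proof.
move=> /(calE_rel_rmorph (free_lift h)) /=; rewrite !free_lift_gen.
have E (s : 'I_r -> calE_sym) :
    (fun i => free_lift h (free_gen (s i))) = (fun i => h (s i)).
  by apply: funext => i; rewrite free_lift_gen.
by rewrite !E; apply: hP.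
Qed.

Definition calE_lift : {rmorphism calE -> A} := rquot_lift calE_lift_subproof.

Lemma calE_lift_gen x : calE_lift (calE_gen x) = h x.
Proof. by rewrite [LHS]rquot_liftE; exact: free_lift_gen. Qed.
End Lift.
End CalE.
Arguments Se {r}.
Arguments Sf {r}.
Arguments calE_e {r}.
Arguments calE_f {r}.

Section FrakE.
Variable r : nat.

Inductive frakE_sym := SP of int & 'I_r | SQ of int & 'I_r | SE | SF.
HB.instance Definition _ := gen_eqMixin frakE_sym.
HB.instance Definition _ := gen_choiceMixin frakE_sym.

Definition frakE_free_rel :
  free_ring frakE_sym -> free_ring frakE_sym -> Prop :=
  frakE_rel (fun a i => free_gen (SP a i)) (fun a i => free_gen (SQ a i))
            (free_gen SE) (free_gen SF).

Definition frakE := ring_quot frakE_free_rel.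
HB.instance Definition _ := GRing.PzRing.on frakE.

Definition frakE_gen (x : frakE_sym) : frakE :=
  rquot_pi frakE_free_rel (free_gen x).
Definition frakE_P (a : int) (i : 'I_r) : frakE := frakE_gen (SP a i).
Definition frakE_Q (a : int) (i : 'I_r) : frakE := frakE_gen (SQ a i).
Definition frakE_E : frakE := frakE_gen SE.
Definition frakE_F : frakE := frakE_gen SF.

Definition frakE_Epow (a : int) : frakE :=
  match a with Posz n => frakE_E ^+ n | Negz n => frakE_F ^+ n.+1 end.

Lemma frakE_relP x y : frakE_rel frakE_P frakE_Q frakE_E frakE_F x y -> x = y.
Proof.
exact: (frakE_rel_image (g := rquot_pi frakE_free_rel) (@rquot_rel _ _)).
Qed.

Section Lift.
Variables (A : pzRingType) (h : frakE_sym -> A).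
Hypothesis hP : forall x y,
  frakE_rel (fun a i => h (SP a i)) (fun a i => h (SQ a i)) (h SE) (h SF) x y ->
  x = y.

Fact frakE_lift_subproof x y :
  frakE_free_rel x y -> free_lift h x = free_lift h y.
Proof.
move=> /(frakE_rel_rmorph (free_lift h)) /=; rewrite !free_lift_gen.
have E (s : int -> 'I_r -> frakE_sym) :
    (fun a i => free_lift h (free_gen (s a i))) = (fun a i => h (s a i)).
  by apply: funext => a; apply: funext => i; rewrite free_lift_gen.
by rewrite !E; apply: hP.
Qed.

Definition frakE_lift : {rmorphism frakE -> A} := rquot_lift frakE_lift_subproof.

Lemma frakE_lift_gen x : frakE_lift (frakE_gen x) = h x.
Proof. by rewrite [LHS]rquot_liftE; exact: free_lift_gen. Qed.
End Lift.
End FrakE.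
Arguments frakE_E {r}.
Arguments frakE_F {r}.
Arguments frakE_Epow {r} a.

Section AnticommutingProducts.
Variables (A : pzRingType) (I : eqType).

Lemma anticomm_prod (x : A) (f : I -> A) (s : seq I) :
  (forall i, i \in s -> x * f i = - (f i * x)) ->
  x * (\prod_(i <- s) f i) = (-1) ^+ size s * ((\prod_(i <- s) f i) * x).
Proof.
elim: s => [|i s IHs] xf; first by rewrite !big_nil mulr1 !mul1r.
rewrite !big_cons mulrA xf ?mem_head // mulNr -mulrA IHs; last first.
  by move=> j js; apply: xf; rewrite inE js orbT.
by rewrite /= exprS mulN1r !mulNr [f i * _]mulrA commr_sign !mulrA.
Qed.

Lemma anticomm_prod0 (f : I -> A) (s : seq I) i :
  (forall i j, f i * f j = - (f j * f i)) -> f i * f i = 0 -> i \in s ->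
  f i * (\prod_(j <- s) f j) = 0.
Proof.
move=> fC fi2; elim: s => // j s IHs; rewrite inE big_cons mulrA.
have [<- _|_ /= /IHs h] := eqVneq i j; first by rewrite fi2 mul0r.
by rewrite fC mulNr -mulrA h mulr0 oppr0.
Qed.
End AnticommutingProducts.

Lemma prod_descE (A : pzRingType) r (p : 'I_r -> A) :
  prod_desc p = \prod_(i <- rev (index_enum 'I_r)) p i.
Proof.
rewrite /prod_desc -(big_map (@rev_ord r) xpredT p); congr bigop.
apply: (inj_map val_inj); rewrite map_rev.
rewrite -[index_enum _]enumT val_enum_ord -map_comp.
apply: (@eq_from_nth _ 0%N) => [|k]; rewrite size_map size_enum_ord.
  by rewrite size_rev size_iota.
move=> kr; rewrite (nth_map (Ordinal kr)) ?size_enum_ord //=.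
rewrite nth_rev ?size_iota // nth_iota ?add0n ?nth_enum_ord //.
by rewrite subnSK // leq_subr.
Qed.

Section RightAction.
Variables (A : pzRingType) (r : nat).
Variables (P Q : int -> 'I_r -> A) (E F : A).
Hypothesis relP : forall x y, frakE_rel P Q E F x y -> x = y.

Lemma relP_clifford x y :
  clifford_rel (fun k : int * 'I_r => P k.1 k.2) (fun k => Q k.1 k.2) x y ->
  x = y.
Proof. by move=> xy; apply/relP/frakE_Cl. Qed.

Lemma PP2 a i : P a i * P a i = 0.
Proof. by rewrite -expr2; apply: relP_clifford (clifford_p2 _ _ (a, i)). Qed.
Lemma QQ2 a i : Q a i * Q a i = 0.
Proof. by rewrite -expr2; apply: relP_clifford (clifford_q2 _ _ (a, i)). Qed.
Lemma PPC a i b j : P a i * P b j = - (P b j * P a i).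
Proof.
apply/eqP; rewrite -addr_eq0; apply/eqP.
exact: relP_clifford (clifford_pp _ _ (a, i) (b, j)).
Qed.
Lemma QQC a i b j : Q a i * Q b j = - (Q b j * Q a i).
Proof.
apply/eqP; rewrite -addr_eq0; apply/eqP.
exact: relP_clifford (clifford_qq _ _ (a, i) (b, j)).
Qed.
Lemma PQC a i b j : P a i * Q b j = ((a, i) == (b, j))%:R - Q b j * P a i.
Proof.
apply/eqP; rewrite -subr_eq opprK; apply/eqP.
exact: relP_clifford (clifford_pq _ _ (a, i) (b, j)).
Qed.
Lemma EEFF : E * F = 1. Proof. exact/relP/frakE_EF. Qed.
Lemma FFEE : F * E = 1. Proof. exact/relP/frakE_FE. Qed.
Lemma EEPP a i : E * P a i = P (a - 1) i * E.
Proof. exact/relP/frakE_EP. Qed.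
Lemma EEQQ a i : E * Q a i = Q (a - 1) i * E.
Proof. exact/relP/frakE_EQ. Qed.
Lemma FFPP a i : F * P a i = P (a + 1) i * F.
Proof.
rewrite -[LHS]mulr1 -EEFF mulrA; congr (_ * _).
by rewrite -[a in LHS](addrK 1) -mulrA -EEPP mulrA FFEE mul1r.
Qed.
Lemma FFQQ a i : F * Q a i = Q (a + 1) i * F.
Proof.
rewrite -[LHS]mulr1 -EEFF mulrA; congr (_ * _).
by rewrite -[a in LHS](addrK 1) -mulrA -EEQQ mulrA FFEE mul1r.
Qed.

Lemma F_prod s :
  F * ((\prod_(i <- rev s) P 0 i) * (\prod_(i <- s) Q 0 i)) * E =
  (\prod_(i <- rev s) P 1 i) * (\prod_(i <- s) Q 1 i).
Proof.
have FP t : F * (\prod_(i <- t) P 0 i) = (\prod_(i <- t) P 1 i) * F.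
  elim: t => [|i t IHt]; first by rewrite !big_nil mulr1 mul1r.
  by rewrite !big_cons mulrA FFPP add0r -mulrA IHt mulrA.
have FQ t : F * (\prod_(i <- t) Q 0 i) = (\prod_(i <- t) Q 1 i) * F.
  elim: t => [|i t IHt]; first by rewrite !big_nil mulr1 mul1r.
  by rewrite !big_cons mulrA FFQQ add0r -mulrA IHt mulrA.
by rewrite mulrA FP -[_ * F * _]mulrA FQ -!mulrA FFEE mulr1.
Qed.

Lemma Q_prod0 i : prod_asc (Q 0) * Q 0 i = 0.
Proof.
apply/eqP; rewrite -(@mulrI_eq0 _ ((-1) ^+ size (index_enum 'I_r))); last first.
  by apply: (can_inj (g := *%R ((-1) ^+ _))) => x; exact: signrMK.
rewrite /prod_asc -anticomm_prod => [|j _]; last exact: QQC.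
rewrite anticomm_prod0 ?QQ2 ?mem_index_enum // => k l; exact: QQC.
Qed.

(* [1_Lambda x = (ract_sym x) 1_Lambda] for each generator [x] of [calE r]. *)
Definition ract_sym (x : calE_sym r) : A :=
  match x with
  | Sp i => P 0 i
  | Sq i => Q 0 i
  | Se => E
  | Sf => F * prod_desc (P 0) * prod_asc (Q 0)
  end.

Variables (M : lmodType A) (one : M).
Hypothesis P_one : forall a i, 0 < a -> P a i *: one = 0.

Lemma P_prodP a i b s : a != b ->
  P a i * (\prod_(j <- s) P b j)
  = (-1) ^+ size s * ((\prod_(j <- s) P b j) * P a i).
Proof. by move=> _; apply: anticomm_prod => j _; apply: PPC. Qed.

Lemma P_prodQ a i b s : (a != b) || (i \notin s) ->
  P a i * (\prod_(j <- s) Q b j)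
  = (-1) ^+ size s * ((\prod_(j <- s) Q b j) * P a i).
Proof.
move=> ab; apply: anticomm_prod => j js; rewrite PQC xpair_eqE.
case: eqP ab => [_ /= iNs|_ _]; last by rewrite sub0r.
by case: eqP iNs js => [->|_ _ _]; rewrite ?sub0r // => /negP.
Qed.

Lemma ract_symP x a i : 0 < a -> P a i *: (ract_sym x *: one) = 0.
Proof.
move=> a0; have an0 : a != 0 by rewrite gt_eqF.
rewrite scalerA; case: x => [j|j||] /=.
- by rewrite PPC scaleNr -scalerA P_one // scaler0 oppr0.
- rewrite PQC xpair_eqE (negPf an0) sub0r scaleNr -scalerA P_one //.
  by rewrite scaler0 oppr0.
- rewrite -[a](addrK 1) -EEPP -scalerA P_one ?scaler0 //.
  by rewrite ltr_wpDl // ltW.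
rewrite !mulrA -[a](subrK 1) -FFPP -2!mulrA -scalerA.
suff -> : (P (a - 1) i * (prod_desc (P 0) * prod_asc (Q 0))) *: one = 0.
  exact: scaler0.
rewrite mulrA prod_descE.
have [a1|a1] := eqVneq (a - 1) 0.
  rewrite a1 anticomm_prod0 ?mul0r ?scale0r ?PP2 //.
    by move=> k l; apply: PPC.
  by rewrite mem_rev mem_index_enum.
rewrite P_prodP // -mulrA -[X in _ * X]mulrA /prod_asc P_prodQ ?a1 //.
rewrite !mulrA -scalerA P_one ?scaler0 //.
by rewrite lt_def a1 subr_ge0 -gtz0_ge1.
Qed.

Hypothesis one_gen : forall u : M, exists a, u = a *: one.
Variable rgen : calE_sym r -> lend M.
Hypothesis rgenE : forall x, rgen x one = ract_sym x *: one.

Local Notation EndL := ((lend M)^c).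

Lemma lend_ext (x y : lend M) : x one = y one -> x = y.
Proof.
move=> xy; apply: linear_ext => u; have [a ->] := one_gen u.
by rewrite !linearZ; congr (_ *: _).
Qed.

Definition represents (x : EndL) (X : A) : Prop :=
  (x : lend M) one = X *: one.

Lemma represents_gen x : represents (rgen x) (ract_sym x).
Proof. exact: rgenE. Qed.

Lemma represents0 : represents 0 0.
Proof. by rewrite /represents scale0r. Qed.

Lemma represents1 : represents 1 1.
Proof. by rewrite /represents scale1r. Qed.

Lemma representsD x y X Y :
  represents x X -> represents y Y -> represents (x + y) (X + Y).
Proof. by move=> xX yY; rewrite /represents scalerDl -xX -yY. Qed.

Lemma represents_nat n : represents n%:R n%:R.
Proof.
elim: n => [|n IHn]; first exact: represents0.
by rewrite !mulrS; apply: representsD => //; apply: represents1.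
Qed.

Lemma representsM x y X Y :
  represents x X -> represents y Y -> represents (x * y) (X * Y).
Proof.
move=> xX yY; rewrite /represents -scalerA -yY -linearZ -xX.
by [].
Qed.

Lemma represents_prod (I : Type) (s : seq I) (x : I -> EndL) X :
  (forall i, represents (x i) (X i)) ->
  represents (\prod_(i <- s) x i) (\prod_(i <- s) X i).
Proof.
move=> xX; elim: s => [|i s IHs]; first by rewrite !big_nil; apply: represents1.
by rewrite !big_cons; apply: representsM.
Qed.

Lemma represents_inj x y X Y :
  represents x X -> represents y Y -> X *: one = Y *: one -> x = y.
Proof. by move=> xX yY XY; apply: lend_ext; rewrite [LHS]xX XY -yY. Qed.

Lemma PQ_prod1 a s : 0 < a -> uniq s ->
  ((\prod_(i <- rev s) P a i) * (\prod_(i <- s) Q a i)) *: one = one.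
Proof.
move=> a0; elim: s => [|i s IHs] /=; first by rewrite !big_nil mulr1 scale1r.
case/andP=> iNs us; rewrite rev_cons big_rcons big_cons /= -[RHS](IHs us).
rewrite -!mulrA [P a i * _]mulrA PQC eqxx mulrBl mul1r mulrBr scalerBl.
rewrite -[X in _ - (_ * X) *: _]mulrA P_prodQ ?iNs ?orbT //.
rewrite !mulrA -[X in _ - X]scalerA P_one // scaler0 subr0.
by [].
Qed.

Lemma ract_rel (x y : EndL) :
  calE_rel (fun i => rgen (Sp i) : EndL) (fun i => rgen (Sq i) : EndL)
    (rgen Se : EndL) (rgen Sf : EndL) x y -> x = y.
Proof.
have G := represents_gen.
case=> [u v|i|i||].
- case=> [i|i|i j|i j|i j].
  + apply: (represents_inj (representsM (G _) (G _)) represents0).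
    by rewrite PP2.
  + apply: (represents_inj (representsM (G _) (G _)) represents0).
    by rewrite QQ2.
  + apply: (represents_inj (representsD (representsM (G _) (G _))
      (representsM (G _) (G _))) represents0).
    by rewrite /= PPC addNr.
  + apply: (represents_inj (representsD (representsM (G _) (G _))
      (representsM (G _) (G _))) represents0).
    by rewrite /= QQC addNr.
  + apply: (represents_inj (representsD (representsM (G _) (G _))
      (representsM (G _) (G _))) (represents_nat _)).
    by rewrite /= PQC subrK xpair_eqE eqxx.
- apply: (represents_inj (representsM (G _) (G _)) represents0).
  by rewrite /= -[0 as X in P X](subrr 1) -EEPP -scalerA P_one // scaler0 scale0r.
- apply: (represents_inj (representsM (G _) (G _)) represents0) => /=.
  by rewrite -mulrA Q_prod0 mulr0.
- apply: (represents_inj (representsM (G _) (G _)) represents1) => /=.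
  rewrite -[F * _ * _]mulrA prod_descE /prod_asc F_prod scale1r.
  by apply: PQ_prod1 => //; apply: index_enum_uniq.
- apply: (represents_inj (representsM (G _) (G _))
    (representsM (represents_prod _ _) (represents_prod _ _))) => [i|i|].
  + exact: G.
  + exact: G.
  by rewrite /= !mulrA EEFF mul1r.
Qed.
End RightAction.

Section Lambda.
Variable r : nat.

Definition frakE_pos (z : frakE r) : Prop :=
  exists a i, 0 < a /\ z = frakE_P a i.

Definition Lambda := cyclic_mod frakE_pos.
HB.instance Definition _ := GRing.Lmodule.on Lambda.
Definition Lambda1 : Lambda := cyclic_gen frakE_pos.

Lemma frakE_P_Lambda1 a i : 0 < a -> frakE_P a i *: Lambda1 = 0.
Proof. by move=> a0; apply: cyclic_rel; exists a, i. Qed.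

Definition Lambda_ract_sym : calE_sym r -> frakE r :=
  ract_sym (@frakE_P r) (@frakE_Q r) frakE_E frakE_F.

Fact Lambda_ract_symP x z : frakE_pos z -> z *: (Lambda_ract_sym x *: Lambda1) = 0.
Proof.
move=> [a [i [a0 ->]]].
exact: (ract_symP (@frakE_relP r) frakE_P_Lambda1).
Qed.

Definition Lambda_ract_gen (x : calE_sym r) : lend Lambda :=
  cyclic_lift (@Lambda_ract_symP x).

Lemma Lambda_ract_genE x :
  Lambda_ract_gen x Lambda1 = Lambda_ract_sym x *: Lambda1.
Proof. exact: cyclic_lift_gen. Qed.

(* The converse ring (_)^c makes a ring morphism a right action. *)
Definition Lambda_ract : {rmorphism calE r -> (lend Lambda)^c} :=
  calE_lift (ract_rel (@frakE_relP r) frakE_P_Lambda1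
    (@cyclic_gen_surj _ frakE_pos) Lambda_ract_genE).

Fact Lambda_ract1 m : (Lambda_ract 1 : lend Lambda) m = m.
Proof. by rewrite rmorph1. Qed.
Fact Lambda_ractM x y m :
  (Lambda_ract (x * y) : lend Lambda) m =
  (Lambda_ract y : lend Lambda) ((Lambda_ract x : lend Lambda) m).
Proof. by rewrite rmorphM. Qed.
Fact Lambda_ractD x y m :
  (Lambda_ract (x + y) : lend Lambda) m =
  (Lambda_ract x : lend Lambda) m + (Lambda_ract y : lend Lambda) m.
Proof. by rewrite rmorphD. Qed.

Definition Lambda_bimod : bimodule (frakE r) (calE r) :=
  Bimodule (bimodule_lmod := Lambda)
    (ract := fun x => Lambda_ract x : lend Lambda)
    Lambda_ract1 Lambda_ractM Lambda_ractD.

Local Notation one := (Lambda1 : Lambda_bimod).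

Lemma Lambda1_gen x : one <* calE_gen x = Lambda_ract_sym x *: one.
Proof.
have h : Lambda_ract (calE_gen x) = Lambda_ract_gen x.
  by rewrite [LHS]calE_lift_gen.
by rewrite -Lambda_ract_genE -h.
Qed.
Lemma Lambda1_e : one <* calE_e = frakE_E *: one.
Proof. exact: Lambda1_gen. Qed.
Lemma Lambda1_f : one <* calE_f =
  (frakE_F * prod_desc (frakE_P 0) * prod_asc (frakE_Q 0)) *: one.
Proof. exact: Lambda1_gen. Qed.
Lemma Lambda1_p i : one <* calE_p i = frakE_P 0 i *: one.
Proof. exact: Lambda1_gen. Qed.
Lemma Lambda1_q i : one <* calE_q i = frakE_Q 0 i *: one.
Proof. exact: Lambda1_gen. Qed.
End Lambda.
Arguments Lambda1 {r}.

Definition calH0 r (W : lmodType (frakE r)) : lmodType (calE r) :=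
  bhom (Lambda_bimod r) W.

Section Vacuum.
Variables (r : nat) (W : lmodType (frakE r)).

Definition is_vacuum : {pred W} :=
  fun w => `[< forall (a : int) (i : 'I_r), 0 < a -> frakE_P a i *: w = 0 >].

Fact vacuum_zmod_closed : zmod_closed is_vacuum.
Proof.
split; first by apply/asboolP => a i _; rewrite scaler0.
move=> u v /asboolP u0 /asboolP v0; apply/asboolP => a i a0.
by rewrite scalerBr u0 // v0 // subr0.
Qed.
HB.instance Definition _ := GRing.isZmodClosed.Build W is_vacuum vacuum_zmod_closed.

Record vacuum := Vacuum { vacuum_val :> W; vacuumP : vacuum_val \in is_vacuum }.
HB.instance Definition _ := [isSub for vacuum_val].
HB.instance Definition _ := [Choice of vacuum by <:].
HB.instance Definition _ := [SubChoice_isSubZmodule of vacuum by <:].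
End Vacuum.

Definition frakHoo r (V : lmodType (calE r)) : lmodType (frakE r) :=
  tensor (Lambda_bimod r) V.

(* Direct limit of a system indexed by the directed set Z, given by its
   transition maps from [D a] to [D (a + 1)]; [io] is the limit cocone. *)
Definition is_direct_limit (D : int -> zmodType)
    (tr : forall a, {additive D a -> D (a + 1)%R})
    (L : zmodType) (io : forall a, {additive D a -> L}) : Prop :=
  (forall a x, io (a + 1) (tr a x) = io a x) /\
  forall (T : zmodType) (k : forall a, {additive D a -> T}),
    (forall a x, k (a + 1) (tr a x) = k a x) ->
    exists h : {additive L -> T},
      (forall a x, h (io a x) = k a x) /\
      forall h' : {additive L -> T}, (forall a x, h' (io a x) = k a x) -> h' =1 h.

Section Tower.
Variables (r : nat) (V : lmodType (calE r)).

Definition tV (a : int) : zmodType := V.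

Definition tV_trans (a : int) : tV a -> tV (a + 1)%R := fun v => calE_e *: (v : V).
Fact tV_trans_is_zmod_morphism a : zmod_morphism (@tV_trans a).
Proof. by move=> u v; rewrite /tV_trans scalerBr. Qed.
HB.instance Definition _ a := GRing.isZmodMorphism.Build (tV a) (tV (a + 1))
  (@tV_trans a) (tV_trans_is_zmod_morphism (a := a)).

(* t^a v is E^{-a} 1_Lambda ⊗ v; since 1_Lambda e = E 1_Lambda, this element
   equals E^{-(a+1)} 1_Lambda ⊗ e v. *)
Definition tV_incl (a : int) : tV a -> frakHoo V :=
  fun v => (frakE_Epow (- a) *: (Lambda1 : Lambda_bimod r)) ⊗ (v : V).
Fact tV_incl_is_zmod_morphism a : zmod_morphism (@tV_incl a).
Proof. exact: tpure_is_zmod_morphism. Qed.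
HB.instance Definition _ a := GRing.isZmodMorphism.Build (tV a) (frakHoo V)
  (@tV_incl a) (tV_incl_is_zmod_morphism (a := a)).
End Tower.

(* Main.v *)
Require Import Defs.
From HB Require Import structures.
From mathcomp Require Import all_boot all_order all_algebra.
From mathcomp Require Import boolp functions.
From mathcomp.multinomials Require Import monalg.

Set Implicit Arguments.
Unset Strict Implicit.
Unset Printing Implicit Defensive.

Import Order.TTheory GRing.Theory Num.Theory.
Local Open Scope ring_scope.

(** The statement on [calH0 W] is the universal property of the cyclic module
[Lambda r]: a homomorphism is determined by the image of [Lambda1], which can be
any vector killed by the [frakE_P a i] with [0 < a].

For [frakHoo V], write [E], [F], [P], [Q] for the generators of [frakE r] and
[iota v] for [Lambda1 ⊗ v], so that [t^a v] is [E^{-a} iota v]. Since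
[Lambda1 e = E Lambda1], the maps [t^a V -> frakHoo V] form a cocone
([tV_incl_trans]). It suffices to show that they are injective and that their
images exhaust [frakHoo V]: a direct limit over the integers is characterized by
these properties ([cocone_universal]).

Both facts rest on one construction inside [calE r]. The relations [f e = 1] and
[e f = p_[r] q_[r]] make [calE r] contain all the modes of index [<= 0]. There
is a map [x |-> shift x] of [calE r], characterized by [shift x * e = e * x] and
anticommutation with all [p_i], [q_i], and the elements [shift^m p_i],
[shift^m q_i] satisfy the relations of [P_{-m,i}], [Q_{-m,i}]
([iter_shift_clifford]). The uniqueness behind this ([shift_uniq], from
[spread_reconstruct]) reflects that the Clifford algebra is a matrix algebra in
which [p_[r] q_[r]] is a rank one idempotent.

Exhaustion ([in_towerP]): [P_{-m,i} iota v = iota (shift^m p_i v)]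
([implements_P]), and likewise for [Q]. Moving a mode past a large power of
[F] lowers its index to a value [<= 0], so the elements [F^n iota v] are stable
under [frakE r].

Injectivity ([tV_incl_inj]): [frakE r] acts on the germs at [+oo] of sequences
in [V] indexed by the integers, [E] by translation and [P_{a,i}] by applying
[shift^(n - a) p_i] to the [n]-th term. The germ of [n |-> e^n v] is killed by
the [P_{a,i}] with [0 < a] because [p_i e = 0], so [iota v] maps to it
([tensor_to_germ]); and this germ is zero only if [v] is, as [f^n e^n = 1]. *)

(** * Expansion of an element along Clifford generators *)

Section Spread.
Variables (A : pzRingType) (I : eqType) (p q : I -> A).
Hypothesis cliffordP : forall x y, clifford_rel p q x y -> x = y.

Lemma clifford_pp0 i : p i * p i = 0.
Proof. exact: cliffordP (clifford_p2 p q i). Qed.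

Lemma clifford_qq0 i : q i * q i = 0.
Proof. exact: cliffordP (clifford_q2 p q i). Qed.

Lemma clifford_ppC i j : p i * p j = - (p j * p i).
Proof. by apply/eqP; rewrite -addr_eq0 (cliffordP (clifford_pp p q i j)). Qed.

Lemma clifford_qqC i j : q i * q j = - (q j * q i).
Proof. by apply/eqP; rewrite -addr_eq0 (cliffordP (clifford_qq p q i j)). Qed.

Lemma clifford_pqC i j : p i * q j = (i == j)%:R - q j * p i.
Proof. by apply/eqP; rewrite -subr_eq opprK (cliffordP (clifford_pq p q i j)). Qed.

Lemma clifford_pqC_neq i j : i != j -> p i * q j = - (q j * p i).
Proof. by rewrite clifford_pqC => /negPf->; rewrite sub0r. Qed.

(** Expanded over subsets [S] of [s], this is the sum of the [± q_S z p_S]. When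
all [p_i z] and [z q_i] vanish, the sign [(-1)^b] attached to each element of [S]
makes the sum commute up to [(-1)^b] with the [p_i], [q_i] for [i] in [s]. *)
Definition spread (b : bool) (z : A) (s : seq I) : A :=
  foldr (fun i y => y + (-1) ^+ b * (q i * y * p i)) z s.

Lemma spread_p0 b z s j : (forall i, p i * z = 0) -> j \notin s ->
  p j * spread b z s = 0.
Proof.
move=> pz; elim: s => //= i s IHs; rewrite inE negb_or => /andP[ji /IHs].
set y := spread _ _ _ => js.
rewrite mulrDr js add0r mulrA commr_sign -!mulrA [p j * _]mulrA.
rewrite clifford_pqC_neq // mulNr -[q i * p j * _]mulrA [p j * (y * _)]mulrA.
by rewrite js mul0r mulr0 oppr0 mulr0.
Qed.

Lemma spread_q0 b z s j : (forall i, z * q i = 0) -> j \notin s ->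
  spread b z s * q j = 0.
Proof.
move=> zq; elim: s => //= i s IHs; rewrite inE negb_or => /andP[ji /IHs].
set y := spread _ _ _ => js.
rewrite mulrDl js add0r -!mulrA clifford_pqC_neq 1?eq_sym //.
by rewrite mulrN [_ * (q j * _)]mulrA js mul0r oppr0 !mulr0.
Qed.

(** The summands with [j] not in [S] are killed by [p_j] from the left, and the
others by [p_j] from the right; [p_j] carries one half onto the other. *)
Lemma spread_anticomm_p z s j : (forall i, p i * z = 0) -> uniq s -> j \in s ->
  p j * spread true z s = - (spread true z s * p j).
Proof.
move=> pz; elim: s => //= i s IHs /andP[iNs us]; rewrite inE mulN1r.
set y := spread _ _ _ in IHs *; have [-> _|ji /= js] := eqVneq j i.
  have y0 : p i * y = 0 by apply: spread_p0.
  rewrite mulrBr mulrBl y0 -!mulrA clifford_pp0 !mulr0 subr0 sub0r.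
  rewrite [p i * _]mulrA clifford_pqC eqxx mulrBl mul1r.
  by rewrite -[q i * p i * _]mulrA [p i * (y * _)]mulrA y0 mul0r mulr0 subr0.
rewrite mulrBr mulrBl IHs // opprB addrC; congr (_ - _).
rewrite -!mulrA [p j * _]mulrA clifford_pqC_neq // mulNr opprK.
rewrite -[q i * p j * _]mulrA [p j * (y * _)]mulrA IHs // mulNr.
by rewrite -[y * p j * _]mulrA (clifford_ppC j i) !mulrN opprK.
Qed.

(** As for [spread_anticomm_p], with the roles of left and right exchanged. *)
Lemma spread_anticomm_q z s j : (forall i, z * q i = 0) -> uniq s -> j \in s ->
  spread true z s * q j = - (q j * spread true z s).
Proof.
move=> zq; elim: s => //= i s IHs /andP[iNs us]; rewrite inE mulN1r.
set y := spread _ _ _ in IHs *; have [-> _|ji /= js] := eqVneq j i.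
  have y0 : y * q i = 0 by apply: spread_q0.
  rewrite mulrBr mulrBl y0 !mulrA clifford_qq0 !mul0r subr0 sub0r.
  rewrite -[_ * p i * q i]mulrA clifford_pqC eqxx mulrBr mulr1.
  by rewrite -[q i * y * _]mulrA [y * (q i * _)]mulrA y0 mul0r mulr0 subr0.
rewrite mulrBr mulrBl IHs // opprB addrC; congr (_ - _).
rewrite -!mulrA clifford_pqC_neq 1?eq_sym // !mulrN opprK.
rewrite [y * (q j * _)]mulrA IHs // mulNr mulrN -[q j * y * _]mulrA.
by rewrite mulrA clifford_qqC mulNr opprK -!mulrA.
Qed.

(** Multiplied out, [1 = prod_i (p_i q_i + q_i p_i)] writes [1] as the sum of the
[± q_S p_[s] q_[s] p_S]; inserting [z], which commutes with the [q_i] up to sign,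
gives [z]. In particular [z] is determined by [z p_[s] q_[s]]. *)
Lemma spread_reconstruct (b : bool) z s : uniq s ->
  (forall i, i \in s -> z * q i = (-1) ^+ b * (q i * z)) ->
  spread b (z * ((\prod_(i <- rev s) p i) * (\prod_(i <- s) q i))) s = z.
Proof.
elim: s z => [|i s IHs] z /=; first by rewrite !big_nil !mulr1.
case/andP=> iNs us zq; rewrite rev_cons big_rcons big_cons /=.
have pqC j : j != i -> p i * q i * q j = q j * (p i * q i).
  move=> ji; rewrite -mulrA clifford_qqC mulrN mulrA.
  by rewrite clifford_pqC_neq 1?eq_sym // mulNr opprK !mulrA.
have pqCp j : j != i -> p j * (p i * q i) = p i * q i * p j.
  move=> ji; rewrite mulrA clifford_ppC mulNr -mulrA.
  by rewrite clifford_pqC_neq // mulrN opprK mulrA.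
have pqCprod t : {subset t <= s} ->
    (\prod_(j <- t) p j) * (p i * q i) = p i * q i * \prod_(j <- t) p j.
  elim: t => [|j t IHt] ts; first by rewrite !big_nil mulr1 mul1r.
  rewrite !big_cons -mulrA IHt; last first.
    by move=> k kt; apply: ts; rewrite inE kt orbT.
  rewrite mulrA pqCp ?mulrA //; apply: contraNneq iNs => <-.
  exact/ts/mem_head.
(* [p_i q_i] is even, so it can be moved to the front of the product; then
   [z p_i q_i] plays the role of [z] for the smaller sequence. *)
have -> : (\prod_(j <- rev s) p j) * p i * (q i * \prod_(j <- s) q j)
    = p i * q i * ((\prod_(j <- rev s) p j) * \prod_(j <- s) q j).
  rewrite mulrA -[_ * p i * q i]mulrA pqCprod ?mulrA // => k.
  by rewrite mem_rev.
rewrite mulrA IHs // => [|j js]; last first.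
  have ji : j != i by apply: contraNneq iNs => <-.
  rewrite -mulrA pqC // mulrA zq; last by rewrite inE js orbT.
  by rewrite -!mulrA.
have -> : (-1) ^+ b * (q i * (z * (p i * q i)) * p i) = z * (q i * p i).
  rewrite !mulrA -[_ * q i * z]mulrA -zq ?mem_head // -!mulrA.
  rewrite [p i * (q i * _)]mulrA clifford_pqC eqxx mulrBl mul1r.
  by rewrite -mulrA clifford_pp0 mulr0 subr0.
by rewrite -mulrDr clifford_pqC eqxx subrK mulr1.
Qed.
End Spread.

(** * The shift of modes inside [calE r] *)

Section Shift.
Variables (A : pzRingType) (r : nat) (p q : 'I_r -> A) (e f : A).
Hypothesis relP : forall x y, calE_rel p q e f x y -> x = y.

Let cliffordP x y : clifford_rel p q x y -> x = y.
Proof. by move=> xy; apply/relP/calE_Cl. Qed.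

Let pe0 i : p i * e = 0. Proof. exact/relP/calE_pe. Qed.
Let fq0 i : f * q i = 0. Proof. exact/relP/calE_fq. Qed.
Let fe1 : f * e = 1. Proof. exact/relP/calE_fe. Qed.
Let ef_prod : e * f = (\prod_(i <- rev (index_enum 'I_r)) p i) *
                      (\prod_(i <- index_enum 'I_r) q i).
Proof. by rewrite -prod_descE; apply/relP/calE_ef. Qed.

(** Uniqueness of the transported element, from which all identities between
shifts are deduced: [y e] determines [y e f = y p_[r] q_[r]], hence [y]. *)
Lemma shift_uniq (b : bool) y z : y * e = z * e ->
  (forall i, y * q i = (-1) ^+ b * (q i * y)) ->
  (forall i, z * q i = (-1) ^+ b * (q i * z)) -> y = z.
Proof.
move=> yz yq zq.
rewrite -(spread_reconstruct cliffordP (index_enum_uniq _) (in1W yq)).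
rewrite -[RHS](spread_reconstruct cliffordP (index_enum_uniq _) (in1W zq)).
by rewrite -ef_prod !mulrA yz.
Qed.

(** The element that anticommutes with the [p_i], [q_i] and satisfies
[shift x * e = e * x]. It lowers the index of a mode by one: if [x] stands for
[P_{a,i}] then [shift x] stands for [P_{a-1,i}]. *)
Definition shift (x : A) : A := spread p q true (e * x * f) (index_enum 'I_r).

Lemma shift_e x : shift x * e = e * x.
Proof.
rewrite /shift; elim: (index_enum _) => [|i s IHs] /=.
  by rewrite -mulrA fe1 mulr1.
by rewrite mulrDl IHs -!mulrA pe0 !mulr0 addr0.
Qed.

Lemma shift_p x i : p i * shift x = - (shift x * p i).
Proof.
apply: spread_anticomm_p; rewrite ?mem_index_enum ?index_enum_uniq // => j.
by rewrite !mulrA pe0 !mul0r.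
Qed.

Lemma shift_q x i : shift x * q i = - (q i * shift x).
Proof.
apply: spread_anticomm_q; rewrite ?mem_index_enum ?index_enum_uniq // => j.
by rewrite -!mulrA fq0 !mulr0.
Qed.

Lemma shift_qM x y i : shift x * shift y * q i = q i * (shift x * shift y).
Proof. by rewrite -mulrA shift_q mulrN mulrA shift_q mulNr opprK mulrA. Qed.

Lemma shift_eM x y : shift x * shift y * e = e * (x * y).
Proof. by rewrite -mulrA shift_e mulrA shift_e mulrA. Qed.

(** Products of two shifts commute with the [q_i] and are moved across [e] like
products of the originals, so [shift_uniq] transports quadratic relations. *)
Lemma shift_anticomm x y (c : nat) : x * y + y * x = c%:R ->
  shift x * shift y + shift y * shift x = c%:R.
Proof.
move=> xy; apply: (@shift_uniq false) => [|i|i]; rewrite ?mul1r.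
- by rewrite mulrDl !shift_eM -mulrDr xy mulr_natr mulr_natl.
- by rewrite mulrDl mulrDr !shift_qM.
- by rewrite mulr_natr mulr_natl.
Qed.

Lemma shift_sq0 x : x * x = 0 -> shift x * shift x = 0.
Proof.
move=> xx; apply: (@shift_uniq false) => [|i|i]; rewrite ?mul1r.
- by rewrite shift_eM xx mulr0 mul0r.
- exact: shift_qM.
- by rewrite mulr0 mul0r.
Qed.

(** Stripping common shifts reduces to the case where one of the exponents is
zero; there, unless both are, one factor is a shift and the other one of the
[p_i], [q_i]. *)
Lemma iter_shift_anticomm x y (c : nat) m n :
  (forall z, x * shift z = - (shift z * x)) ->
  (forall z, shift z * y = - (y * shift z)) -> x * y + y * x = c%:R ->
  iter m shift x * iter n shift y + iter n shift y * iter m shift x =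
  ((m == n) * c)%:R.
Proof.
move=> xC yC xy; elim: m n => [|m IHm] [|n] /=; first by rewrite mul1n.
- by rewrite xC addNr.
- by rewrite yC addNr.
exact/shift_anticomm/IHm.
Qed.

Lemma fX_eX m : f ^+ m * e ^+ m = 1.
Proof.
elim: m => [|m IHm]; first by rewrite mulr1.
by rewrite exprSr exprS -mulrA [f * (e * _)]mulrA fe1 mul1r.
Qed.

Lemma eX_inj (V : lmodType A) m (v : V) : e ^+ m *: v = 0 -> v = 0.
Proof. by move=> ev; rewrite -[v]scale1r -(fX_eX m) -scalerA ev scaler0. Qed.

Lemma iter_shift_e m x : iter m shift x * e ^+ m = e ^+ m * x.
Proof.
elim: m => [|m IHm] /=; first by rewrite mulr1 mul1r.
by rewrite exprS mulrA shift_e -mulrA IHm mulrA.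
Qed.

Lemma iter_shift_p_e i m k :
  iter m shift (p i) * e ^+ (m + k.+1) = 0.
Proof.
rewrite exprD mulrA iter_shift_e exprS -!mulrA [p i * _]mulrA pe0.
by rewrite mul0r mulr0.
Qed.

Lemma iter_shift_clifford x y :
  clifford_rel (fun k : nat * 'I_r => iter k.1 shift (p k.2))
    (fun k => iter k.1 shift (q k.2)) x y -> x = y.
Proof.
have pC i z : shift z * p i = - (p i * shift z) by rewrite shift_p opprK.
have qC i z : q i * shift z = - (shift z * q i) by rewrite shift_q opprK.
case=> [[m i]|[m i]|[m i] [n j]|[m i] [n j]|[m i] [n j]] /=.
- rewrite expr2; elim: m => [|m IHm] /=; last exact: shift_sq0.
  exact: clifford_pp0 cliffordP i.
- rewrite expr2; elim: m => [|m IHm] /=; last exact: shift_sq0.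
  exact: clifford_qq0 cliffordP i.
- rewrite (iter_shift_anticomm (c := 0)) ?muln0 // => [z|].
    exact: shift_p.
  exact: cliffordP (clifford_pp p q i j).
- rewrite (iter_shift_anticomm (c := 0)) ?muln0 // => [z|].
    exact: shift_q.
  exact: cliffordP (clifford_qq p q i j).
- rewrite (iter_shift_anticomm (c := (i == j))) => [|z|z|].
  + by rewrite mulnb xpair_eqE.
  + exact: shift_p.
  + exact: shift_q.
  exact: cliffordP (clifford_pq p q i j).
Qed.
End Shift.

(** * The modes of [frakE r] *)

Section ModeAlgebra.
Variables (A : pzRingType) (r : nat) (P Q : int -> 'I_r -> A) (E F : A).
Hypothesis relP : forall x y, frakE_rel P Q E F x y -> x = y.

Lemma mode0_clifford x y : clifford_rel (P 0) (Q 0) x y -> x = y.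
Proof.
move=> xy; apply/relP/frakE_Cl; case: xy => [i|i|i j|i j|i j].
- exact: (clifford_p2 _ _ (0, i)).
- exact: (clifford_q2 _ _ (0, i)).
- exact: (clifford_pp _ _ (0, i) (0, j)).
- exact: (clifford_qq _ _ (0, i) (0, j)).
- have := clifford_pq (fun k => P k.1 k.2) (fun k => Q k.1 k.2) (0, i) (0, j).
  by rewrite xpair_eqE eqxx.
Qed.

(** [F P_[r] Q_[r]] is the element by which [calE_f] acts on the vacuum, and
[E F P_[r] Q_[r] = P_[r] Q_[r]]. So the formula defining [shift], evaluated in
the large algebra, simplifies to conjugation by [E]. *)
Lemma spread_conj X Y : E * X * F = Y ->
  (forall i, Y * Q 0 i = - (Q 0 i * Y)) ->
  spread (P 0) (Q 0) true (E * X * (F * prod_desc (P 0) * prod_asc (Q 0)))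
    (index_enum 'I_r) = Y.
Proof.
move=> XY YQ.
have -> : E * X * (F * prod_desc (P 0) * prod_asc (Q 0)) =
    Y * (prod_desc (P 0) * prod_asc (Q 0)) by rewrite -XY !mulrA.
rewrite prod_descE.
apply: (spread_reconstruct mode0_clifford (index_enum_uniq _)) => i _.
by rewrite YQ mulN1r.
Qed.

Lemma conj_P a i : E * P a i * F = P (a - 1) i.
Proof. by rewrite (EEPP relP) -mulrA (EEFF relP) mulr1. Qed.

Lemma conj_Q a i : E * Q a i * F = Q (a - 1) i.
Proof. by rewrite (EEQQ relP) -mulrA (EEFF relP) mulr1. Qed.

Lemma P_neg_Q0 m i j : P (- m.+1%:Z) i * Q 0 j = - (Q 0 j * P (- m.+1%:Z) i).
Proof. by rewrite (PQC relP) xpair_eqE oppr_eq0 /= sub0r. Qed.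

Lemma FX_P n a i : F ^+ n * P a i = P (a + n%:Z) i * F ^+ n.
Proof.
elim: n a => [|n IHn] a; first by rewrite mulr1 mul1r addr0.
by rewrite exprSr -mulrA (FFPP relP) mulrA IHn -!mulrA -!exprSr -addrA -intS.
Qed.

Lemma FX_Q n a i : F ^+ n * Q a i = Q (a + n%:Z) i * F ^+ n.
Proof.
elim: n a => [|n IHn] a; first by rewrite mulr1 mul1r addr0.
by rewrite exprSr -mulrA (FFQQ relP) mulrA IHn -!mulrA -!exprSr -addrA -intS.
Qed.

Lemma FXn_EXn n : F ^+ n * E ^+ n = 1.
Proof.
elim: n => [|n IHn]; first by rewrite mulr1.
by rewrite exprSr exprS -mulrA [F * (E * _)]mulrA (FFEE relP) mul1r.
Qed.

Lemma EXn_FXn n : E ^+ n * F ^+ n = 1.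
Proof.
elim: n => [|n IHn]; first by rewrite mulr1.
by rewrite exprSr exprS -mulrA [E * (F * _)]mulrA (EEFF relP) mul1r.
Qed.
End ModeAlgebra.

(** * Induction principles *)

Section FreeQuotientInduction.
Variables (X : choiceType) (rel : free_ring X -> free_ring X -> Prop).
Variable K : ring_quot rel -> Prop.
Hypothesis K1 : K 1.
Hypothesis KB : forall x y, K x -> K y -> K (x - y).
Hypothesis KM : forall x y, K x -> K y -> K (x * y).
Hypothesis Kgen : forall x, K (rquot_pi rel (free_gen x)).

(** Modulo the subgroup spanned by [K], the quotient map from the free ring
vanishes on words, hence everywhere. *)
Lemma rquot_free_ind x : K x.
Proof.
have K0 : K 0 by rewrite -(subrr 1); apply: KB.
have Kspan y : zspan_spec K y -> K y by elim=> // *; apply: KB.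
have Kword s : K (rquot_pi rel << FMonom s >>).
  elim: s => [|k s IHs].
    have -> : << FMonom [::] >> = 1 :> free_ring X.
      by congr << _ >>; apply/eqP; rewrite fmP fm1.
    by rewrite rmorph1.
  have -> : << FMonom (k :: s) >> = free_gen k * << FMonom s >> :> free_ring X.
    rewrite malgM_def fgmulUU mulr1; congr << _ >>.
    by apply/eqP; rewrite fmP fmM fmuE.
  by rewrite rmorphM; apply: KM => //; apply: Kgen.
have [y ->] := rquot_surj x; apply: Kspan; rewrite -[rquot_pi _ _]subr0.
apply/zpiP; rewrite raddf0.
apply: (malg_lift_uniq (f := zpi K \o rquot_pi rel) (g := \0)) => -[s] /=.
by rewrite -(raddf0 (zpi K)); apply/zpiP/zspan_mem; rewrite subr0.
Qed.
End FreeQuotientInduction.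

Lemma tensor_ind (A R : pzRingType) (M : bimodule A R) (V : lmodType R)
    (K : tensor M V -> Prop) :
  K 0 -> (forall x y, K x -> K y -> K (x - y)) -> (forall m v, K (m ⊗ v)) ->
  forall u, K u.
Proof.
move=> K0 KB Kpure u.
have Kspan x : zspan_spec K x -> K x by elim=> // *; apply: KB.
apply: Kspan; rewrite -[u]subr0; apply/zpiP; rewrite raddf0.
apply: (tensor_uniq (f := zpi K) (g := \0)) => m v /=.
by rewrite -(raddf0 (zpi K)); apply/zpiP/zspan_mem; rewrite subr0.
Qed.

(** * Vectors on which [frakE r] acts through [calE r] *)

Definition calE_shift r : calE r -> calE r :=
  shift (@calE_p r) (@calE_q r) calE_e calE_f.

Section Implements.
Variables (r : nat) (V : lmodType (calE r)) (M : lmodType (frakE r)).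
Variable iota : {additive V -> M}.

Local Notation P := (@frakE_P r).
Local Notation Q := (@frakE_Q r).
Local Notation E := (@frakE_E r).
Local Notation F := (@frakE_F r).

(** The relation between [X] and [y] saying that left multiplication by [X]
preserves the image of [iota] and is given there by [y]; it is compatible with
sums and products. The two instances of [iota] are [v |-> Lambda1 ⊗ v] and
[const_germ]. *)
Definition implements (X : frakE r) (y : calE r) : Prop :=
  forall v, X *: iota v = iota (y *: v).

Lemma implements1 : implements 1 1.
Proof. by move=> v; rewrite !scale1r. Qed.

Lemma implementsB X X' y y' :
  implements X y -> implements X' y' -> implements (X - X') (y - y').
Proof. by move=> Xy Xy' v; rewrite !scalerBl raddfB /= -Xy -Xy'. Qed.

Lemma implementsM X X' y y' :
  implements X y -> implements X' y' -> implements (X * X') (y * y').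
Proof. by move=> Xy Xy' v; rewrite -!scalerA Xy' Xy. Qed.

Lemma implementsX X y n : implements X y -> implements (X ^+ n) (y ^+ n).
Proof.
move=> Xy; elim: n => [|n IHn]; first exact: implements1.
by rewrite !exprS; apply: implementsM.
Qed.

Lemma implements_spread (I : eqType) (p q : I -> frakE r) p' q' X y s :
  (forall i, implements (p i) (p' i)) -> (forall i, implements (q i) (q' i)) ->
  implements X y -> implements (spread p q true X s) (spread p' q' true y s).
Proof.
move=> pp' qq' Xy; elim: s => //= i s IHs; rewrite !mulN1r.
by apply: implementsB => //; do !apply: implementsM.
Qed.

Hypothesis iota_gen :
  forall x, implements (Lambda_ract_sym x) (calE_gen x).

Lemma implements_shift X Y y : E * X * F = Y ->
  (forall i, Y * Q 0 i = - (Q 0 i * Y)) ->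
  implements X y -> implements Y (calE_shift y).
Proof.
move=> XY YQ Xy; rewrite -(spread_conj (@frakE_relP r) XY YQ).
apply: implements_spread => [i|i|].
- exact: iota_gen (Sp i).
- exact: iota_gen (Sq i).
- do 2?apply: implementsM => //; [exact: iota_gen Se|exact: iota_gen Sf].
Qed.

(** By induction on [m]: the shift on the side of [calE r] corresponds to
conjugation by [E], by [spread_conj]. *)
Lemma implements_P m i :
  implements (P (- m%:Z) i) (iter m (@calE_shift r) (calE_p i)).
Proof.
elim: m => [|m IHm] /=; first exact: iota_gen (Sp i).
apply: implements_shift IHm => [|j]; last exact: P_neg_Q0 (@frakE_relP r) m i j.
by rewrite (conj_P (@frakE_relP r)) -opprD addrC -intS.
Qed.

Lemma implements_Q m i :
  implements (Q (- m%:Z) i) (iter m (@calE_shift r) (calE_q i)).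
Proof.
elim: m => [|m IHm] /=; first exact: iota_gen (Sq i).
apply: implements_shift IHm => [|j]; last exact: QQC (@frakE_relP r) _ _ _ _.
by rewrite (conj_Q (@frakE_relP r)) -opprD addrC -intS.
Qed.
End Implements.

Section Tower.
Variables (r : nat) (V : lmodType (calE r)) (M : lmodType (frakE r)).
Variable iota : {additive V -> M}.
Hypothesis iota_gen :
  forall x, implements iota (Lambda_ract_sym x) (calE_gen x).

(** The levels [t^n] with [0 <= n] already contain the others, since [E^n] maps
[iota v] to [iota (e^n v)]. *)
Definition in_tower (u : M) : Prop :=
  exists n v, u = frakE_F ^+ n *: iota v.

Lemma iota_raise n v :
  frakE_F ^+ n *: iota (calE_e ^+ n *: v) = iota v.
Proof.
rewrite -(implementsX n (iota_gen Se) v) scalerA.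
by rewrite (FXn_EXn (@frakE_relP r)) scale1r.
Qed.

Lemma in_tower_raise N u : in_tower u ->
  exists n v, (N <= n)%N /\ u = frakE_F ^+ n *: iota v.
Proof.
move=> [n [v ->]]; exists (n + N)%N, (calE_e ^+ N *: v).
by rewrite leq_addl exprD -scalerA iota_raise.
Qed.

Lemma in_towerB u w : in_tower u -> in_tower w -> in_tower (u - w).
Proof.
move=> [m [v ->]] [n [v' ->]]; exists (m + n)%N.
exists (calE_e ^+ n *: v - calE_e ^+ m *: v').
rewrite (raddfB iota) scalerBr; congr (_ - _).
  by rewrite exprD -scalerA iota_raise.
by rewrite addnC exprD -scalerA iota_raise.
Qed.

(** For [P_{a,i}], raise the level [n] above [a]; then
[P_{a,i} F^n = F^n P_{a-n,i}] and the mode [a - n] is implemented on the image of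
[iota]. *)
Lemma in_tower_gen x u : in_tower u -> in_tower (frakE_gen x *: u).
Proof.
have lower (T : int -> 'I_r -> frakE r) (t : 'I_r -> calE r) a i :
    (forall n b j, frakE_F ^+ n * T b j = T (b + n%:Z) j * frakE_F ^+ n) ->
    (forall m j, implements iota (T (- m%:Z) j) (iter m (@calE_shift r) (t j))) ->
    in_tower u -> in_tower (T a i *: u).
  move=> FT Tt /(in_tower_raise `|a|)[n [v [an ->]]].
  have [m am] : exists m : nat, a - n%:Z = - m%:Z.
    exists `|n%:Z - a|%N; rewrite gez0_abs ?opprB // subr_ge0.
    by apply: le_trans (ler_norm a) _; rewrite -abszE lez_nat.
  exists n, (iter m (@calE_shift r) (t i) *: v).
  by rewrite -(Tt m i v) !scalerA -am FT subrK.
case: x => [a i|a i||].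
- exact: lower (FX_P (@frakE_relP r)) (implements_P iota_gen).
- exact: lower (FX_Q (@frakE_relP r)) (implements_Q iota_gen).
- move=> /(in_tower_raise 1)[[|n] [v []]] // _ ->; exists n, v.
  by rewrite exprS scalerA mulrA (EEFF (@frakE_relP r)) mul1r.
- by move=> [n [v ->]]; exists n.+1, v; rewrite exprS scalerA.
Qed.

Lemma in_towerZ X u : in_tower u -> in_tower (X *: u).
Proof.
apply: (rquot_free_ind (K := fun X : frakE r => forall u : M,
  in_tower u -> in_tower (X *: u))) X u => [u|X Y KX KY u tu|X Y KX KY u tu|x u].
- by rewrite scale1r.
- by rewrite scalerBl; apply: in_towerB; [apply: KX|apply: KY].
- by rewrite -scalerA; apply/KX/KY.
- exact: in_tower_gen.
Qed.
End Tower.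

Section Filtration.
Variables (r : nat) (V : lmodType (calE r)).

Definition vac_tensor : {additive V -> frakHoo V} :=
  tpure (Lambda1 : Lambda_bimod r).

Lemma vac_tensor_gen x :
  implements vac_tensor (Lambda_ract_sym x) (calE_gen x).
Proof.
by move=> v; rewrite [LHS]tensor_scaleE -Lambda1_gen [LHS]tpure_balance.
Qed.

Lemma in_towerP u : in_tower vac_tensor u.
Proof.
apply: tensor_ind u => [|u w|m v].
- by exists 0%N, 0; rewrite raddf0 scaler0.
- exact: (in_towerB vac_tensor_gen).
have [X ->] := cyclic_gen_surj m.
have -> : (X *: cyclic_gen (@frakE_pos r) : Lambda_bimod r) ⊗ v = X *: vac_tensor v.
  exact/esym/tensor_scaleE.
by apply: (in_towerZ vac_tensor_gen); exists 0%N, v; rewrite scale1r.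
Qed.
End Filtration.

(** * Germs of sequences *)

Section Germs.
Variables (R : pzRingType) (V : lmodType R).

Definition eventually0 (x : int -> V) : Prop :=
  exists N, forall n, N <= n -> x n = 0.

Definition germ := zquot eventually0.
HB.instance Definition _ := GRing.Zmodule.on germ.

Definition germ_of : (int -> V) -> germ := zpi eventually0.
HB.instance Definition _ := GRing.Additive.on germ_of.

Lemma germ_ofP (x y : int -> V) :
  germ_of x = germ_of y <-> exists N, forall n, N <= n -> x n = y n.
Proof.
have subE (u v : int -> V) n : (u - v) n = u n - v n by [].
rewrite zpiP; split=> [|[N xy]]; last first.
  by apply: zspan_mem; exists N => n /xy xyn; rewrite subE xyn subrr.
suff h z : zspan_spec eventually0 z -> eventually0 z.
  move=> /h[N xy]; exists N => n /xy; rewrite subE.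
  by move/subr0_eq.
elim=> // [|{}x {}y _ [M xM] _ [N yN]]; first by exists 0.
exists (Num.max M N) => n; rewrite ge_max => /andP[/xM xn /yN yn].
by rewrite subE xn yn subrr.
Qed.

Section Operator.
Variables (d : int) (c : int -> R).

Definition seq_op (x : int -> V) : germ := germ_of (fun n => c n *: x (n + d)).

Fact seq_op_is_zmod_morphism : zmod_morphism seq_op.
Proof.
move=> x y; rewrite /seq_op -raddfB; congr germ_of.
by apply: funext => n; exact: scalerBr.
Qed.
HB.instance Definition _ :=
  GRing.isZmodMorphism.Build (int -> V) germ seq_op seq_op_is_zmod_morphism.

Fact seq_op_eventually0 x : eventually0 x -> seq_op x = 0.
Proof.
move=> [N xN]; rewrite -(raddf0 germ_of); apply/germ_ofP.
by exists (N - d) => n; rewrite lerBlDr => /xN ->; exact: scaler0.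
Qed.

(** [zmodule germ] is [germ] seen as a module over the integers: all its additive
endomorphisms are linear, so that [lend] is the full endomorphism ring. *)
Definition germ_op_fun : zmodule germ -> zmodule germ := zlift seq_op_eventually0.
HB.instance Definition _ := GRing.Additive.on germ_op_fun.

Fact germ_op_is_scalable : scalable germ_op_fun.
Proof. by move=> n u; exact: raddfMz. Qed.
HB.instance Definition _ := GRing.isScalable.Build int (zmodule germ)
  (zmodule germ) *:%R germ_op_fun germ_op_is_scalable.

Definition germ_op : lend (zmodule germ) := germ_op_fun.

Lemma germ_opE x : germ_op (germ_of x) = germ_of (fun n => c n *: x (n + d)).
Proof. exact: zliftE. Qed.
End Operator.

Lemma germ_op_ext (S T : lend (zmodule germ)) :
  (forall x, S (germ_of x) = T (germ_of x)) -> S = T.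
Proof.
by move=> ST; apply: linear_ext => u; have [x ->] := zpi_surj u; exact: ST.
Qed.

Lemma eq_germ_op d c c' : (exists N, forall n, N <= n -> c n = c' n) ->
  germ_op d c = germ_op d c'.
Proof.
move=> [N cc']; apply: germ_op_ext => x; rewrite !germ_opE.
by apply/germ_ofP; exists N => n /cc' ->.
Qed.

Lemma germ_opM d d' c c' : germ_op d c * germ_op d' c' =
  germ_op (d + d') (fun n => c n * c' (n + d)).
Proof.
apply: germ_op_ext => x; rewrite germ_opE.
have -> : (germ_op d c * germ_op d' c') (germ_of x) =
    germ_op d c (germ_of (fun n => c' n *: x (n + d'))).
  by rewrite -(germ_opE d' c').
by rewrite germ_opE; congr germ_of; apply: funext => n; rewrite scalerA addrA.
Qed.

Lemma germ_opD d c c' :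
  germ_op d c + germ_op d c' = germ_op d (fun n => c n + c' n).
Proof.
apply: germ_op_ext => x; rewrite lhomDE !germ_opE -[LHS](raddfD germ_of).
by congr germ_of; apply: funext => n; rewrite [RHS]scalerDl.
Qed.

Lemma germ_op_nat k : germ_op 0 (fun=> k%:R) = k%:R.
Proof.
elim: k => [|k IHk].
  apply: germ_op_ext => x; rewrite germ_opE -[RHS](raddf0 germ_of).
  by congr germ_of; apply: funext => n; rewrite [LHS]scale0r.
rewrite [RHS]mulrS -IHk.
have -> : 1 = germ_op 0 (fun=> 1) :> lend _.
  apply: germ_op_ext => x; rewrite germ_opE; congr germ_of.
  by apply: funext => n; rewrite scale1r addr0.
by rewrite germ_opD; apply: eq_germ_op; exists 0 => n _; rewrite -mulrS.
Qed.
Lemma germ_op0M c c' :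
  germ_op 0 c * germ_op 0 c' = germ_op 0 (fun n => c n * c' n).
Proof.
by rewrite germ_opM addr0; congr germ_op; apply: funext => n; rewrite addr0.
Qed.

Lemma germ_op_shift c c' : (forall n, c (n + 1) = c' n) ->
  germ_op 1 (fun=> 1) * germ_op 0 c = germ_op 0 c' * germ_op 1 (fun=> 1).
Proof.
move=> cc'; rewrite !germ_opM addr0 add0r; congr germ_op.
by apply: funext => n; rewrite mul1r mulr1 cc'.
Qed.

Lemma germ_opV d d' : d + d' = 0 ->
  germ_op d (fun=> 1) * germ_op d' (fun=> 1) = 1.
Proof.
move=> dd'; rewrite germ_opM dd' -[RHS](germ_op_nat 1); congr germ_op.
by apply: funext => n; rewrite mulr1.
Qed.

Lemma germ_op0MD c c' : germ_op 0 c * germ_op 0 c' + germ_op 0 c' * germ_op 0 c =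
  germ_op 0 (fun n => c n * c' n + c' n * c n).
Proof. by rewrite !germ_op0M germ_opD. Qed.
End Germs.

(** * The action on germs *)

Section GermAction.
Variables (r : nat) (V : lmodType (calE r)).

(** Read at the place [n], the mode of index [a] becomes the mode of index [a - n],
which lives in [calE r] as soon as [a <= n]. The absolute value puts arbitrary
operators at the places [n < a], which germs at [+oo] do not see. *)
Definition germ_sym (x : frakE_sym r) : lend (zmodule (germ V)) :=
  match x with
  | SP a i => germ_op V 0 (fun n => iter `|n - a| (@calE_shift r) (calE_p i))
  | SQ a i => germ_op V 0 (fun n => iter `|n - a| (@calE_shift r) (calE_q i))
  | SE => germ_op V 1 (fun=> 1)
  | SF => germ_op V (-1) (fun=> 1)
  end.

Let germ_op0_nat (c : int -> calE r) (k : nat) :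
  (exists N, forall n, N <= n -> c n = k%:R) -> germ_op V 0 c = k%:R.
Proof. by move=> /(@eq_germ_op _ V 0) ->; exact: (@germ_op_nat _ V). Qed.

Lemma germ_symP x y :
  frakE_rel (fun a i => germ_sym (SP a i)) (fun a i => germ_sym (SQ a i))
    (germ_sym (SE r)) (germ_sym (SF r)) x y -> x = y.
Proof.
have C := iter_shift_clifford (@calE_relP r).
case=> {x y}[x y|||a i|a i].
- case=> [k|k|k l|k l|k l].
  + rewrite expr2 [LHS]germ_op0M; apply: (@germ_op0_nat _ 0); exists 0 => n _.
    by rewrite -expr2; exact: C (clifford_p2 _ _ (`|n - k.1|%N, k.2)).
  + rewrite expr2 [LHS]germ_op0M; apply: (@germ_op0_nat _ 0); exists 0 => n _.
    by rewrite -expr2; exact: C (clifford_q2 _ _ (`|n - k.1|%N, k.2)).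
  + rewrite [LHS]germ_op0MD; apply: (@germ_op0_nat _ 0); exists 0 => n _.
    exact: C (clifford_pp _ _ (`|n - k.1|%N, k.2) (`|n - l.1|%N, l.2)).
  + rewrite [LHS]germ_op0MD; apply: (@germ_op0_nat _ 0); exists 0 => n _.
    exact: C (clifford_qq _ _ (`|n - k.1|%N, k.2) (`|n - l.1|%N, l.2)).
  + rewrite [LHS]germ_op0MD; apply: (@germ_op0_nat _ (k == l)).
    exists (Num.max k.1 l.1) => n; rewrite ge_max => /andP[kn ln].
    rewrite [LHS](C _ _ (clifford_pq _ _ (`|n - k.1|%N, k.2) (`|n - l.1|%N, l.2))).
    case: k l kn ln => [a i] [b j] /= an bn; rewrite !xpair_eqE.
    by rewrite -eqz_nat !gez0_abs ?subr_ge0 // (inj_eq (addrI n)) eqr_opp.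
- exact: germ_opV.
- exact: germ_opV.
- by apply: germ_op_shift => n; rewrite opprB addrA addrAC.
- by apply: germ_op_shift => n; rewrite opprB addrA addrAC.
Qed.

Definition germ_act : {rmorphism frakE r -> lend (zmodule (germ V))} :=
  frakE_lift germ_symP.

Definition germ_mod := germ V.
HB.instance Definition _ := GRing.Zmodule.on germ_mod.

Definition germ_scale (X : frakE r) (u : germ_mod) : germ_mod := germ_act X u.

Fact germ_scaleA X Y u : germ_scale X (germ_scale Y u) = germ_scale (X * Y) u.
Proof. by rewrite /germ_scale rmorphM. Qed.
Fact germ_scale1 : left_id 1 germ_scale.
Proof. by move=> u; rewrite /germ_scale rmorph1. Qed.
Fact germ_scaleDr : right_distributive germ_scale +%R.
Proof. by move=> X u v; exact: raddfD. Qed.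
Fact germ_scaleDl u : {morph germ_scale^~ u : X Y / X + Y}.
Proof. by move=> X Y; rewrite /germ_scale rmorphD. Qed.
HB.instance Definition _ := GRing.Zmodule_isLmodule.Build (frakE r) germ_mod
  germ_scaleA germ_scale1 germ_scaleDr germ_scaleDl.

Lemma germ_scale_gen (x : frakE_sym r) (u : germ_mod) :
  frakE_gen x *: u = germ_sym x u.
Proof.
have <- : germ_act (frakE_gen x) = germ_sym x by exact: frakE_lift_gen.
by [].
Qed.

Lemma germ_scale_P a i x : frakE_P a i *: (germ_of x : germ_mod) =
  germ_of (fun n => iter `|n - a| (@calE_shift r) (calE_p i) *: x n).
Proof.
rewrite germ_scale_gen [LHS]germ_opE; congr germ_of.
by apply: funext => n; rewrite addr0.
Qed.

Lemma germ_scale_Q a i x : frakE_Q a i *: (germ_of x : germ_mod) =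
  germ_of (fun n => iter `|n - a| (@calE_shift r) (calE_q i) *: x n).
Proof.
rewrite germ_scale_gen [LHS]germ_opE; congr germ_of.
by apply: funext => n; rewrite addr0.
Qed.

Lemma germ_scale_E x :
  frakE_E *: (germ_of x : germ_mod) = germ_of (fun n => x (n + 1)).
Proof.
rewrite germ_scale_gen [LHS]germ_opE; congr germ_of.
by apply: funext => n; rewrite scale1r.
Qed.

(** The germ that [v] at level [0] must represent: at level [n] it becomes
[e^n v]. *)
Definition const_germ (v : V) : germ_mod := germ_of (fun n => calE_e ^+ `|n| *: v).
Fact const_germ_is_zmod_morphism : zmod_morphism const_germ.
Proof.
move=> u v; rewrite /const_germ -[RHS](raddfB (@germ_of _ V)); congr germ_of.
by apply: funext => n; exact: scalerBr.
Qed.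
HB.instance Definition _ := GRing.isZmodMorphism.Build V germ_mod const_germ
  const_germ_is_zmod_morphism.

(** A vanishing germ gives [e^n v = 0] for some [n], and [e] has the left inverse
[f]. *)
Lemma const_germ_inj v : const_germ v = 0 -> v = 0.
Proof.
rewrite -[0](raddf0 (@germ_of _ V)) => /germ_ofP[N v0].
apply: (eX_inj (@calE_relP r) (m := `|Num.max N 0|)).
by apply: v0; rewrite le_max lexx.
Qed.

(** For [0 < a <= n], [shift^(n-a) p_i] moved across [e^(n-a)] becomes [p_i],
which meets the remaining factor [e^a]. *)
Lemma const_germ_vacuum a i v : 0 < a -> frakE_P a i *: const_germ v = 0.
Proof.
move=> a0; rewrite germ_scale_P -[0](raddf0 (@germ_of _ V)).
apply/germ_ofP; exists a => n an; rewrite scalerA.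
have -> : `|n|%N = (`|n - a| + `|a|)%N.
  apply/eqP; rewrite -eqz_nat PoszD !gez0_abs ?subr_ge0 ?subrK // ?ltW //.
  exact: lt_le_trans an.
case: a a0 {an} => [[|a]|] // _.
by rewrite (iter_shift_p_e (@calE_relP r)) scale0r.
Qed.

(** The case of [f] follows from those of the other generators:
[P_[r] Q_[r]] acts on [const_germ v] as [p_[r] q_[r] = e f], and [F] undoes
[e]. *)
Lemma const_germ_gen x :
  implements const_germ (Lambda_ract_sym x) (calE_gen x).
Proof.
have gp i : implements const_germ (frakE_P 0 i) (calE_p i).
  move=> v; rewrite germ_scale_P; congr germ_of; apply: funext => n.
  by rewrite subr0 !scalerA (iter_shift_e (@calE_relP r)).
have gq i : implements const_germ (frakE_Q 0 i) (calE_q i).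
  move=> v; rewrite germ_scale_Q; congr germ_of; apply: funext => n.
  by rewrite subr0 !scalerA (iter_shift_e (@calE_relP r)).
have ge : implements const_germ frakE_E calE_e.
  move=> v; rewrite germ_scale_E; apply/germ_ofP; exists 0 => -[n|//] _.
  by rewrite scalerA -exprSr -PoszD addn1.
have prodP (I : Type) (s : seq I) X y :
    (forall i, implements const_germ (X i) (y i)) ->
    implements const_germ (\prod_(i <- s) X i) (\prod_(i <- s) y i).
  move=> Xy; elim: s => [|i s IHs]; first by rewrite !big_nil; exact: implements1.
  by rewrite !big_cons; exact: implementsM.
case: x => [i|i||] //= v.
have -> : frakE_F * prod_desc (@frakE_P r 0) * prod_asc (@frakE_Q r 0) =
    frakE_F * (prod_desc (@frakE_P r 0) * prod_asc (@frakE_Q r 0)).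
  by rewrite mulrA.
rewrite -scalerA.
have -> : (prod_desc (@frakE_P r 0) * prod_asc (@frakE_Q r 0)) *: const_germ v =
    const_germ (prod_desc (@calE_p r) * prod_asc (@calE_q r) *: v).
  by apply: implementsM; exact: prodP.
rewrite -(calE_relP (calE_ef _ _ _ _)) -scalerA -ge scalerA.
by rewrite (FFEE (@frakE_relP r)) scale1r.
Qed.
End GermAction.

Lemma ractB (A R : pzRingType) (M : bimodule A R) (m : M) (x y : R) :
  m <* (x - y) = m <* x - m <* y.
Proof. by apply/eqP; rewrite eq_sym subr_eq -ractD subrK. Qed.

Section TensorToGerm.
Variables (r : nat) (V : lmodType (calE r)).

Fact const_germ_pos (v : V) X : frakE_pos X -> X *: const_germ v = 0.
Proof. by move=> [a [i [a0 ->]]]; exact: const_germ_vacuum. Qed.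

(** [X Lambda1 ⊗ v |-> X const_germ v]. Balancedness in [calE r] has to be
checked only on generators, where it is [const_germ_gen]. *)
Lemma tensor_to_germ : exists phi : {additive frakHoo V -> germ_mod V},
  forall v, phi (vac_tensor V v) = const_germ v.
Proof.
pose h (m : Lambda_bimod r) v : germ_mod V := cyclic_lift (@const_germ_pos v) m.
have hE X v : h (X *: Lambda1) v = X *: const_germ v.
  exact: cyclic_lift_scale_gen.
have hZ X m v : h (X *: m) v = X *: h m v by exact: linearZ.
have hDl m m' v : h (m + m') v = h m v + h m' v by exact: raddfD.
have hDr m v v' : h m (v + v') = h m v + h m v'.
  have [X ->] := cyclic_gen_surj m.
  by rewrite !hE raddfD scalerDr.
have hbal m y v : h (m <* y) v = h m (y *: v).
  move: m v; apply: (rquot_free_ind (K := fun y : calE r =>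
    forall m v, h (m <* y) v = h m (y *: v))) y
    => [m v|y z Ky Kz m v|y z Ky Kz m v|x m v].
  - by rewrite ract1 scale1r.
  - have hBl n n' : h (n - n') v = h n v - h n' v by exact: raddfB.
    have hBr n w w' : h n (w - w') = h n w - h n w'.
      by apply/eqP; rewrite eq_sym subr_eq -hDr subrK.
    by rewrite ractB hBl Ky Kz -hBr -scalerBl.
  - by rewrite ractM Kz Ky scalerA.
  have [X ->] := cyclic_gen_surj m.
  have -> : (X *: Lambda1 : Lambda_bimod r) <* calE_gen x =
      X *: (Lambda_ract_sym x *: Lambda1).
    by rewrite -Lambda1_gen; exact: linearZ.
  rewrite [LHS]hZ [RHS]hE (hE (Lambda_ract_sym x)).
  congr (_ *: _); exact: const_germ_gen.
have [phi phiE] := tensor_lift_ex hDl hDr hbal.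
exists phi => v; rewrite [LHS]phiE -[Lambda1]scale1r hE; exact: scale1r.
Qed.
End TensorToGerm.

(** * Direct limits along the integers *)

Section DirectLimit.
Variables (V L : zmodType) (e : V -> V) (io : int -> {additive V -> L}).
Hypothesis io_e : forall a v, io (a + 1) (e v) = io a v.
Hypothesis io_inj : forall a, injective (io a).
Hypothesis io_surj : forall u, exists a v, u = io a v.

Section Cocone.
Variables (T : zmodType) (k : int -> {additive V -> T}).
Hypothesis k_e : forall a v, k (a + 1) (e v) = k a v.

Let raise (W : Type) (c : int -> V -> W) a v m :
  (forall b w, c (b + 1) (e w) = c b w) -> c (a + m%:Z) (iter m e v) = c a v.
Proof.
move=> ce; elim: m => [|m IHm] /=; first by rewrite addr0.
by rewrite intS [1 + _]addrC addrA ce.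
Qed.

(** Compare both elements at the larger level, where injectivity of [io] turns
the equality of images into an equality in [V]. *)
Lemma cocone_eq a b v w : io a v = io b w -> k a v = k b w.
Proof.
wlog ab : a b v w / a <= b => [IH|].
  have [/IH|/ltW ba ioE] := leP a b; first exact.
  by apply/esym/(IH b a) => //; apply: esym.
have -> : b = a + `|b - a|%N%:Z by rewrite gez0_abs ?subr_ge0 // addrCA subrr addr0.
rewrite -(raise (c := fun a v => io a v) a v `|b - a|%N io_e) => /io_inj <-.
by rewrite (raise (c := fun a v => k a v)).
Qed.

Lemma common_level u w :
  exists a v v', u = io a v /\ w = io a v'.
Proof.
have [a [v ->]] := io_surj u; have [b [v' ->]] := io_surj w.
have up c d x : c <= d -> exists y, io c x = io d y.
  move=> cd; exists (iter `|d - c|%N e x).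
  rewrite -(raise (c := fun a v => io a v) c x `|d - c|%N io_e).
  by rewrite gez0_abs ?subr_ge0 // addrCA subrr addr0.
have [x ->] : exists x, io a v = io (Num.max a b) x by apply: up; rewrite le_max lexx.
have [y ->] : exists y, io b v' = io (Num.max a b) y.
  by apply: up; rewrite le_max lexx orbT.
by exists (Num.max a b), x, y.
Qed.

Fact limit_map_subproof u : exists t, forall a v, u = io a v -> t = k a v.
Proof.
have [a [v ->]] := io_surj u; exists (k a v) => b w; exact: cocone_eq.
Qed.

Definition limit_map (u : L) : T := sval (cid (limit_map_subproof u)).

Lemma limit_mapE a v : limit_map (io a v) = k a v.
Proof. exact: (svalP (cid (limit_map_subproof (io a v)))). Qed.

Fact limit_map_is_zmod_morphism : zmod_morphism limit_map.
Proof.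
move=> u w; have [a [v [v' [-> ->]]]] := common_level u w.
by rewrite -raddfB !limit_mapE raddfB.
Qed.
HB.instance Definition _ :=
  GRing.isZmodMorphism.Build L T limit_map limit_map_is_zmod_morphism.
End Cocone.

Lemma cocone_universal (T : zmodType) (k : int -> {additive V -> T}) :
  (forall a v, k (a + 1) (e v) = k a v) ->
  exists h : {additive L -> T}, (forall a v, h (io a v) = k a v) /\
    forall h' : {additive L -> T}, (forall a v, h' (io a v) = k a v) -> h' =1 h.
Proof.
move=> k_e; exists (limit_map k_e); split=> [a v|h' h'E u]; first exact: limit_mapE.
by have [a [v ->]] := io_surj u; rewrite h'E [RHS]limit_mapE.
Qed.
End DirectLimit.

(** * The theorem *)

Section TowerInclusions.
Variables (r : nat) (V : lmodType (calE r)).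

Lemma tV_inclE a (v : V) :
  @tV_incl r V a v = frakE_Epow (- a) *: vac_tensor V v.
Proof. exact/esym/tensor_scaleE. Qed.

Lemma Epow_succ c : frakE_Epow c * frakE_E = frakE_Epow (c + 1) :> frakE r.
Proof.
case: c => [n|[|n]]; first by rewrite /= -exprSr addn1.
  exact: FFEE (@frakE_relP r).
have -> : Negz n.+1 + 1 = Negz n.
  by rewrite !NegzE (intS n.+1) opprD addrAC addNr add0r.
by rewrite /= exprSr -mulrA (FFEE (@frakE_relP r)) mulr1.
Qed.

Lemma EpowN c : frakE_Epow (- c) * frakE_Epow c = 1 :> frakE r.
Proof.
case: c => [[|n]|n]; first by rewrite oppr0 mulr1.
  exact: FXn_EXn (@frakE_relP r) _.
rewrite NegzE opprK; exact: EXn_FXn (@frakE_relP r) _.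
Qed.

Lemma tV_incl_trans a (v : V) : @tV_incl r V (a + 1) (calE_e *: v) = @tV_incl r V a v.
Proof.
rewrite !tV_inclE -(vac_tensor_gen (V := V) Se v) scalerA Epow_succ.
by rewrite opprD subrK.
Qed.

(** All levels are translates of the level [0] by powers of [E]. *)
Lemma tV_incl_inj a : injective (@tV_incl r V a).
Proof.
suff inj0 v : @tV_incl r V a v = 0 -> v = 0.
  move=> v w vw; apply/subr0_eq/inj0.
  apply: etrans (raddfB (@tV_incl r V a) v w) _.
  by apply/eqP; rewrite subr_eq0; apply/eqP.
have [phi phiE] := tensor_to_germ V.
rewrite tV_inclE => /(congr1 ( *:%R (frakE_Epow a))).
rewrite scalerA -[a in frakE_Epow a]opprK EpowN scale1r scaler0 => v0.
by apply: const_germ_inj; rewrite -phiE v0 raddf0.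
Qed.

Lemma tV_incl_surj (u : frakHoo V) : exists a v, u = @tV_incl r V a v.
Proof.
have [n [v ->]] := in_towerP u; exists n%:Z, v.
by rewrite tV_inclE; case: n.
Qed.
End TowerInclusions.

Section VacuumEvaluation.
Variables (r : nat) (W : lmodType (frakE r)).

Fact eval_vacuum_subproof (phi : calH0 W) :
  (phi : {linear Lambda r -> W}) Lambda1 \in @is_vacuum r W.
Proof.
by apply/asboolP => a i a0; rewrite -linearZ frakE_P_Lambda1 // raddf0.
Qed.

Definition eval_vacuum (phi : calH0 W) : vacuum W :=
  Vacuum (eval_vacuum_subproof phi).

Fact eval_vacuum_is_zmod_morphism : zmod_morphism eval_vacuum.
Proof. by move=> phi psi; apply: val_inj. Qed.
HB.instance Definition _ := GRing.isZmodMorphism.Build (calH0 W) (vacuum W)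
  eval_vacuum eval_vacuum_is_zmod_morphism.

Fact vacuum_pos (w : vacuum W) X : frakE_pos X -> X *: vacuum_val w = 0.
Proof. by move=> [a [i [a0 ->]]]; move/asboolP: (vacuumP w); apply. Qed.

(** The inverse sends a vacuum vector to the homomorphism it defines on the
cyclic module. *)
Lemma eval_vacuum_bij : bijective eval_vacuum.
Proof.
exists (fun w => cyclic_lift (@vacuum_pos w) : {linear Lambda r -> W}) => [phi|w].
  apply: linear_ext => u; have [X ->] := cyclic_gen_surj u.
  by rewrite [LHS]cyclic_lift_scale_gen [RHS]linearZ.
by apply: val_inj; exact: cyclic_lift_gen.
Qed.
End VacuumEvaluation.

Theorem corollary6p2 (r : nat) (hr : (0 < r)%N) :
  (forall W : lmodType (frakE r),
     exists g : {additive calH0 W -> vacuum W},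
       bijective g /\
       forall phi : {linear Lambda r -> W}, vacuum_val (g phi) = phi Lambda1) /\
  (forall V : lmodType (calE r),
     is_direct_limit (D := tV V) (L := frakHoo V)
       (fun a => @tV_trans r V a) (fun a => @tV_incl r V a) /\
     forall a : int, injective (@tV_incl r V a)).
Proof.
split=> [W|V].
  by exists (@eval_vacuum r W); split=> //; exact: eval_vacuum_bij.
split=> [|a]; last exact: tV_incl_inj.
split=> [|T k ke]; first exact: tV_incl_trans.
exact: (cocone_universal (io := fun a => @tV_incl r V a)
  (@tV_incl_trans r V) (@tV_incl_inj r V) (@tV_incl_surj r V) ke).
Qed.
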